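(* Let $p\geq 1$ be a real number, let $\mathbb{D}$ be the open unit disc of $\mathbb{C}$ and let $v_p(z)=(1-|z|^2)^p$ for $z\in\mathbb{D}$. Then $H^\infty_{v_p}(\mathbb{D},F)$ has the $WH^\infty$-BPB property for every complex Banach space $F$.
   Context: Notation: $B_X$, $S_X$ are the closed unit ball and unit sphere of a Banach space $X$; $\mathbb{T}$ is the unit circle of $\mathbb{C}$. A weight on an open set $U$ is a strictly positive continuous function on $U$. $H^\infty_v(U,F)$ is the Banach space of holomorphic mappings $f:U\to F$ with $\|f\|_v:=\sup\{v(z)\|f(z)\|: z\in U\}<\infty$; $H^\infty_v(U):=H^\infty_v(U,\mathbb{C})$. $G^\infty_v(U)$ is the space of all linear functionals on $H^\infty_v(U)$ whose restriction to $B_{H^\infty_v(U)}$ is continuous for the compact-open topology; it is a closed subspace of $H^\infty_v(U)^*$, with the norm of $H^\infty_v(U)^*$. For $z\in U$, $\delta_z\in G^\infty_v(U)$ is the evaluation $\delta_z(f)=f(z)$. $WH^\infty$-BPB property: $H^\infty_v(U,F)$ has the $WH^\infty$-BPB property if for every $0<\varepsilon<1$ there is $0<\eta(\varepsilon)<\varepsilon$ such that for every $f\in S_{H^\infty_v(U,F)}$, every $\lambda\in\mathbb{T}$ and every $z\in U$ with $v(z)\|f(z)\|>1-\eta(\varepsilon)$, there exist $f_0\in S_{H^\infty_v(U,F)}$, $\lambda_0\in\mathbb{T}$ and $z_0\in U$ such that $v(z_0)\|f_0(z_0)\|=1$, $\|f-f_0\|_v<\varepsilon$ and $\|\lambda v(z)\delta_z-\lambda_0v(z_0)\delta_{z_0}\|<\varepsilon$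 (the last norm being that of $G^\infty_v(U)$). *)

(* Defs.v *)
(* Stdlib reals with Coquelicot.  A complex Banach space is a
   [CompleteNormedModule C_AbsRing]. *)
From Stdlib Require Import Reals Lra List.
From Coquelicot Require Import Coquelicot.
Open Scope R_scope.

(* Mappings on an open set U of a complex normed space E are represented by
   total functions on E; every notion below depends only on their values on U. *)

(* Fréchet differentiability over C. *)
Definition holomorphic_on {E F : NormedModule C_AbsRing}
    (U : E -> Prop) (f : E -> F) : Prop :=
  forall z, U z -> ex_filterdiff f (locally z).

Definition is_weight {E : NormedModule C_AbsRing}
    (U : E -> Prop) (v : E -> R) : Prop :=
  forall z, U z ->
    0 < v z /\ filterlim v (within U (locally z)) (locally (v z)).

Definition wnorm {E F : NormedModule C_AbsRing}
    (U : E -> Prop) (v : E -> R) (f : E -> F) : Rbar :=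
  Lub_Rbar (fun r => exists z, U z /\ r = v z * norm (f z)).

Definition Hinf {E F : NormedModule C_AbsRing}
    (U : E -> Prop) (v : E -> R) (f : E -> F) : Prop :=
  holomorphic_on U f /\ Rbar_lt (wnorm U v f) p_infty.

Definition Hinf_ball {E F : NormedModule C_AbsRing}
    (U : E -> Prop) (v : E -> R) (f : E -> F) : Prop :=
  Hinf U v f /\ Rbar_le (wnorm U v f) 1.

Definition Hinf_sphere {E F : NormedModule C_AbsRing}
    (U : E -> Prop) (v : E -> R) (f : E -> F) : Prop :=
  Hinf U v f /\ wnorm U v f = Finite 1.

Definition compact_set {E : UniformSpace} (K : E -> Prop) : Prop :=
  forall (I : Type) (O : I -> E -> Prop),
    (forall i, open (O i)) ->
    (forall x, K x -> exists i, O i x) ->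
    exists l : list I, forall x, K x -> exists i, In i l /\ O i x.

(* The space G^infty_v(U).  The first clause says that phi factors through
   restriction to U, i.e. is a function on H^infty_v(U); the last one is
   continuity on the closed unit ball for uniform convergence on the compact
   subsets of U. *)
Definition Ginf {E : NormedModule C_AbsRing}
    (U : E -> Prop) (v : E -> R) (phi : (E -> C) -> C) : Prop :=
  (forall f g : E -> C, Hinf U v f -> Hinf U v g ->
     (forall z, U z -> f z = g z) -> phi f = phi g) /\
  (forall f g : E -> C, Hinf U v f -> Hinf U v g ->
     phi (fun z => (f z + g z)%C) = (phi f + phi g)%C) /\
  (forall (a : C) (f : E -> C), Hinf U v f ->
     phi (fun z => (a * f z)%C) = (a * phi f)%C) /\
  (forall f : E -> C, Hinf_ball U v f -> forall e, 0 < e ->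
     exists K : E -> Prop, compact_set K /\ (forall z, K z -> U z) /\
     exists d, 0 < d /\
     forall g : E -> C, Hinf_ball U v g ->
       (forall z, K z -> Cmod (g z - f z)%C < d) ->
       Cmod (phi g - phi f)%C < e).

(* Norm of H^infty_v(U)^*, hence also of its subspace G^infty_v(U). *)
Definition dual_norm {E : NormedModule C_AbsRing}
    (U : E -> Prop) (v : E -> R) (phi : (E -> C) -> C) : Rbar :=
  Lub_Rbar (fun r => exists f : E -> C, Hinf_ball U v f /\ r = Cmod (phi f)).

Definition delta {E : NormedModule C_AbsRing} (z : E) : (E -> C) -> C :=
  fun f => f z.

Definition WHinf_BPB {E : NormedModule C_AbsRing}
    (U : E -> Prop) (v : E -> R) (F : NormedModule C_AbsRing) : Prop :=
  forall eps, 0 < eps < 1 ->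
  exists eta, 0 < eta < eps /\
  forall (f : E -> F) (lambda : C) (z : E),
    Hinf_sphere U v f -> Cmod lambda = 1 -> U z ->
    v z * norm (f z) > 1 - eta ->
  exists (f0 : E -> F) (lambda0 : C) (z0 : E),
    Hinf_sphere U v f0 /\ Cmod lambda0 = 1 /\ U z0 /\
    v z0 * norm (f0 z0) = 1 /\
    Rbar_lt (wnorm U v (fun w => minus (f w) (f0 w))) eps /\
    Rbar_lt
      (dual_norm U v (fun h => (lambda * v z * delta z h
                                - lambda0 * v z0 * delta z0 h)%C))
      eps.

Definition unit_disc : C_NormedModule -> Prop := fun z => Cmod z < 1.

Definition disc_weight (p : R) : C_NormedModule -> R :=
  fun z => Rpower (1 - Cmod z ^ 2) p.

(* The functionals measured in [WHinf_BPB] do belong to G^infty_v(U). *)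
Lemma Ginf_delta_comb {E : NormedModule C_AbsRing} (U : E -> Prop)
    (v : E -> R) (a b : C) (x y : E) :
  U x -> U y -> Ginf U v (fun h => (a * delta x h - b * delta y h)%C).
Proof.
intros Ux Uy; unfold delta; repeat split.
- intros f g _ _ fg; now rewrite (fg x Ux), (fg y Uy).
- intros f g _ _; ring.
- intros c f _; ring.
- intros f _ e e0.
  exists (fun z => z = x \/ z = y); repeat split.
  + intros I O _ cov.
    destruct (cov x (or_introl eq_refl)) as [i Hi].
    destruct (cov y (or_intror eq_refl)) as [j Hj].
    exists (i :: j :: nil); intros z [-> | ->].
    * exists i; simpl; auto.
    * exists j; simpl; auto.
  + intros z [-> | ->]; assumption.
  + pose proof (Cmod_ge_0 a) as a0; pose proof (Cmod_ge_0 b) as b0.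
    set (M := Cmod a + Cmod b + 1).
    assert (M0 : 0 < M) by (unfold M; lra).
    exists (e / M); split; [now apply Rdiv_lt_0_compat|].
    intros g _ Hg.
    pose proof (Hg x (or_introl eq_refl)) as Hx.
    pose proof (Hg y (or_intror eq_refl)) as Hy.
    replace (a * g x - b * g y - (a * f x - b * f y))%C
      with (a * (g x - f x) + - (b * (g y - f y)))%C by ring.
    apply Rle_lt_trans with (1 := Cmod_triangle _ _).
    rewrite Cmod_opp, !Cmod_mult.
    assert (eM : e = Cmod a * (e / M) + Cmod b * (e / M) + e / M).
    { replace (_ + _ + _) with (M * (e / M)) by (unfold M; ring).
      field; lra. }
    assert (0 < e / M) by now apply Rdiv_lt_0_compat.
    assert (Cmod a * Cmod (g x - f x)%C <= Cmod a * (e / M)).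
    { apply Rmult_le_compat_l; lra. }
    assert (Cmod b * Cmod (g y - f y)%C <= Cmod b * (e / M)).
    { apply Rmult_le_compat_l; lra. }
    lra.
Qed.

Lemma disc_weight_is_weight (p : R) : is_weight unit_disc (disc_weight p).
Proof.
intros z Uz; split; [apply exp_pos|].
apply (filterlim_filter_le_1 (F := locally z) (G := within unit_disc (locally z)) (H := locally (disc_weight p z))
  (disc_weight p)).
{ intros P [d Hd]; exists d; intros y yd _; exact (Hd y yd). }
assert (H : 0 < 1 - Cmod z ^ 2).
{ unfold unit_disc in Uz; pose proof (Cmod_ge_0 z); nra. }
change (continuous (fun w : C_NormedModule =>
  (fun t => exp (p * ln (1 - t ^ 2))) (Cmod w)) z).
apply (continuous_comp (fun w : C_NormedModule => Cmod w)
  (fun t => exp (p * ln (1 - t ^ 2)))).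
- exact (@filterlim_norm C_AbsRing C_NormedModule z).
- apply (@ex_derive_continuous R_AbsRing R_NormedModule).
  auto_derive; lra.
Qed.

(* Main.v *)
(* With g_z(w) = ((1 - |z|^2) / (1 - conj z * w)^2)^p one has v_p(w) |g_z(w)| =
   v_p(phi_z(w)), where phi_z is the involutive automorphism of the disc that
   exchanges 0 and z.  If v_p(z) ||f(z)|| > 1 - eta, add to f the bump g_z * x
   with x a small positive multiple of f(z): the weighted norm of the sum at z
   exceeds everything it takes outside a small pseudohyperbolic disc about z, so
   its supremum is attained at some z0 in that disc, and f0 is the normalised sum.
   For h in the unit ball, K = (h o phi_z) g_z satisfies |K| <= 1 / v_p, and
   v_p(z) h(z), v_p(z0) h(z0) are K(0) and, up to a phase independent of h,
   v_p(b) K(b) with b = phi_z(z0) near 0; so the distance of the evaluations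
   is controlled by a Schwarz estimate for K.  Holomorphic means
   differentiable at each point, so the latter rests on Goursat's theorem. *)
Require Import Defs.
From Stdlib Require Import Reals Lra Lia Classical ClassicalEpsilon.
From Coquelicot Require Import Coquelicot.
Open Scope R_scope.

(** * Bisection *)

(** The obstacle is uniformity: eta may depend on eps but neither on z, which can approach the
    boundary, nor on f, whose weighted supremum need not be attained. The weighted modulus of g_z is
    1 at z and at most (1 - r^2)^p outside the pseudohyperbolic disc of radius r, whatever z is; the
    gap between these two values, scaled by the norm of x, is what eta has to stay below. Since x
    points along f(z), the triangle inequality is an equality at z, and no supporting functional is
    needed. For the F-valued sum, only continuity of its weighted norm on a compact disc is used to
    attain the supremum. Function theory is applied to the scalar h alone. There the derivative is
    not known to be continuous, which rules out Green's formula, and the difference quotient in the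
    Schwarz estimate is only known to be continuous at 0, so the maximum principle has to tolerate
    one exceptional point. *)

Lemma nested_dyadic_point (u : nat -> R) (L : R) :
  0 <= L -> (forall n, u n <= u (S n)) ->
  (forall n, u (S n) + (/ 2) ^ S n * L <= u n + (/ 2) ^ n * L) ->
  exists x, forall n, u n <= x <= u n + (/ 2) ^ n * L.
Proof.
intros HL Hu Hv.
assert (up : forall n k, u n <= u (n + k)%nat).
{ intros n k; induction k as [|k IH]; [rewrite Nat.add_0_r; lra|].
  rewrite Nat.add_succ_r; specialize (Hu (n + k)%nat); lra. }
assert (dn : forall n k,
  u (n + k)%nat + (/ 2) ^ (n + k) * L <= u n + (/ 2) ^ n * L).
{ intros n k; induction k as [|k IH]; [rewrite Nat.add_0_r; lra|].
  rewrite Nat.add_succ_r; specialize (Hv (n + k)%nat); lra. }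
assert (pos : forall n, 0 <= (/ 2) ^ n * L).
{ intros n; apply Rmult_le_pos; [apply pow_le; lra|exact HL]. }
(* Every left end lies below every right end, so the supremum of the left ends lies in all the
   intervals. *)
assert (cross : forall n m, u m <= u n + (/ 2) ^ n * L).
{ intros n m; destruct (Nat.le_gt_cases n m) as [H|H].
  - specialize (dn n (m - n)%nat); specialize (pos (n + (m - n))%nat).
    replace (n + (m - n))%nat with m in * by lia; lra.
  - specialize (up m (n - m)%nat); specialize (pos n).
    replace (m + (n - m))%nat with n in * by lia; lra. }
destruct (completeness (fun r => exists n, r = u n)) as [x [Hub Hlub]].
- exists (u 0%nat + (/ 2) ^ 0 * L); intros r [n ->]; apply cross.
- exists (u 0%nat), 0%nat; reflexivity.
- exists x; intros n; split.
  + apply Hub; now exists n.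
  + apply Hlub; intros r [m ->]; apply cross.
Qed.

(* Cousin's lemma for the boxes [x, x + t L1] x [y, y + t L2]. *)
Lemma box_bisection (L1 L2 a b : R) (P : R -> R -> R -> Prop) :
  0 <= L1 -> 0 <= L2 ->
  (forall x y t, 0 < t ->
     P x y (t / 2) -> P (x + t / 2 * L1) y (t / 2) ->
     P x (y + t / 2 * L2) (t / 2) ->
     P (x + t / 2 * L1) (y + t / 2 * L2) (t / 2) -> P x y t) ->
  (forall x0 y0, a <= x0 <= a + L1 -> b <= y0 <= b + L2 ->
     exists d, 0 < d /\
     forall x y t, 0 < t < d ->
       a <= x <= x0 -> x0 <= x + t * L1 <= a + L1 ->
       b <= y <= y0 -> y0 <= y + t * L2 <= b + L2 -> P x y t) ->
  P a b 1.
Proof.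
intros HL1 HL2 Hsplit Hloc; apply NNPP; intros Hnot.
set (dec := excluded_middle_informative).
(* Selects the first quarter on which [P] fails. The fourth quarter is the default when the other
   three are good; [Hsplit] then makes it bad. *)
set (step := fun (t : R) (q : R * R) =>
  if dec (P (fst q) (snd q) (t / 2)) then
    if dec (P (fst q + t / 2 * L1) (snd q) (t / 2)) then
      if dec (P (fst q) (snd q + t / 2 * L2) (t / 2)) then
        (fst q + t / 2 * L1, snd q + t / 2 * L2)
      else (fst q, snd q + t / 2 * L2)
    else (fst q + t / 2 * L1, snd q)
  else q).
set (s := fix s n := match n with
  | O => (a, b) | S n => step ((/ 2) ^ n) (s n) end).
assert (pw : forall n, 0 < (/ 2) ^ n) by (intros n; apply pow_lt; lra).
assert (bad : forall n, ~ P (fst (s n)) (snd (s n)) ((/ 2) ^ n)).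
{ induction n as [|n IH]; [exact Hnot|].
  replace ((/ 2) ^ S n) with ((/ 2) ^ n / 2) by (simpl; field).
  simpl s; unfold step; intros H; apply IH; clear IH.
  revert H; repeat destruct (dec _); simpl; intros; try tauto; auto. }
assert (inc1 : forall n, fst (s n) <= fst (s (S n)) /\
  fst (s (S n)) + (/ 2) ^ S n * L1 <= fst (s n) + (/ 2) ^ n * L1).
{ intros n; specialize (pw n); assert (0 <= (/ 2) ^ n * L1) by nra.
  replace ((/ 2) ^ S n) with ((/ 2) ^ n / 2) by (simpl; field).
  simpl s; unfold step; repeat destruct (dec _); simpl; lra. }
assert (inc2 : forall n, snd (s n) <= snd (s (S n)) /\
  snd (s (S n)) + (/ 2) ^ S n * L2 <= snd (s n) + (/ 2) ^ n * L2).
{ intros n; specialize (pw n); assert (0 <= (/ 2) ^ n * L2) by nra.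
  replace ((/ 2) ^ S n) with ((/ 2) ^ n / 2) by (simpl; field).
  simpl s; unfold step; repeat destruct (dec _); simpl; lra. }
assert (in1 : forall n, a <= fst (s n) /\ fst (s n) + (/ 2) ^ n * L1 <= a + L1).
{ induction n as [|n IH]; [simpl; lra|]. specialize (inc1 n); lra. }
assert (in2 : forall n, b <= snd (s n) /\ snd (s n) + (/ 2) ^ n * L2 <= b + L2).
{ induction n as [|n IH]; [simpl; lra|]. specialize (inc2 n); lra. }
destruct (nested_dyadic_point (fun n => fst (s n)) L1) as [x0 Hx]; auto;
  try (intros n; apply inc1).
destruct (nested_dyadic_point (fun n => snd (s n)) L2) as [y0 Hy]; auto;
  try (intros n; apply inc2).
destruct (Hloc x0 y0) as (d & d0 & Hd).
{ specialize (Hx 0%nat); simpl in Hx; lra. }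
{ specialize (Hy 0%nat); simpl in Hy; lra. }
destruct (pow_lt_1_zero (/ 2)) with (y := d) as [n Hn]; auto.
{ rewrite Rabs_pos_eq; lra. }
specialize (Hn n (le_n n)); rewrite Rabs_pos_eq in Hn by (specialize (pw n); lra).
apply (bad n), Hd.
- split; [apply pw|exact Hn].
- split; [apply in1|apply Hx].
- split; [apply Hx|apply in1].
- split; [apply in2|apply Hy].
- split; [apply Hy|apply in2].
Qed.

Lemma Cmod_le_sub (a b : C) : Cmod a <= Cmod (a - b) + Cmod b.
Proof.
replace a with (a - b + b)%C at 1 by ring; apply Cmod_triangle.
Qed.

Lemma Cmod_Re_Im (z : C) : Cmod z <= Rabs (fst z) + Rabs (snd z).
Proof.
replace z with (RtoC (fst z) + Ci * RtoC (snd z))%C at 1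
  by (destruct z; unfold Ci, RtoC, Cplus, Cmult; simpl; f_equal; ring).
eapply Rle_trans; [apply Cmod_triangle|].
rewrite Cmod_mult, Cmod_Ci, !Cmod_R; lra.
Qed.

Lemma disc_max_attained (r : R) (f : C -> R) :
  0 <= r ->
  (forall z, Cmod z <= r -> forall e, 0 < e -> exists d, 0 < d /\
     forall w, Cmod (w - z)%C < d -> f w < f z + e) ->
  exists c, Cmod c <= r /\ forall w, Cmod w <= r -> f w <= f c.
Proof.
intros Hr Hf.
(* Otherwise every value is dominated by another one, and being dominated on
   the part of a box lying in the disc is a local and additive property. *)
apply NNPP; intros Hno.
assert (Hdom : forall z, Cmod z <= r -> exists c, Cmod c <= r /\ f z < f c).
{ intros z Hz; apply NNPP; intros H; apply Hno; exists z; split; auto.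
  intros w Hw; apply Rnot_lt_le; intros Hlt; apply H; now exists w. }
assert (HP : exists c, Cmod c <= r /\ forall u v, - r <= u <= - r + 1 * (2 * r) ->
    - r <= v <= - r + 1 * (2 * r) -> Cmod (u, v) <= r -> f (u, v) < f c).
{ apply (box_bisection (2 * r) (2 * r) (- r) (- r) (fun x y t =>
    exists c, Cmod c <= r /\ forall u v, x <= u <= x + t * (2 * r) ->
    y <= v <= y + t * (2 * r) -> Cmod (u, v) <= r -> f (u, v) < f c));
    try lra.
  - intros x y t Ht (c1 & H1 & G1) (c2 & H2 & G2) (c3 & H3 & G3) (c4 & H4 & G4).
    assert (Hmax : forall c c', Cmod c <= r -> Cmod c' <= r ->
      exists c'', Cmod c'' <= r /\ f c <= f c'' /\ f c' <= f c'').
    { intros c c' Hc Hc'; destruct (Rle_dec (f c) (f c'));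
        [exists c'|exists c]; repeat split; auto; lra. }
    destruct (Hmax c1 c2) as (m1 & ? & ? & ?); auto.
    destruct (Hmax c3 c4) as (m2 & ? & ? & ?); auto.
    destruct (Hmax m1 m2) as (m & ? & ? & ?); auto.
    exists m; split; auto; intros u v Hu Hv Huv.
    destruct (Rle_dec u (x + t / 2 * (2 * r)));
      destruct (Rle_dec v (y + t / 2 * (2 * r))).
    + specialize (G1 u v); lra.
    + specialize (G3 u v); lra.
    + specialize (G2 u v); lra.
    + specialize (G4 u v); lra.
  - intros x0 y0 _ _.
    destruct (Rle_dec (Cmod (x0, y0)) r) as [Hin|Hout].
    + destruct (Hdom _ Hin) as (c & Hc & Hlt).
      destruct (Hf _ Hin (f c - f (x0, y0))) as (d & d0 & Hd); [lra|].
      (* A box of scale t has sides 2rt, so its points are within 4rt of (x0, y0); the + 1 covers r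
         = 0. *)
      exists (d / (4 * r + 1)); split; [apply Rdiv_lt_0_compat; lra|].
      intros x y t [Ht0 Ht] Hx Hx' Hy Hy'; exists c; split; auto.
      intros u v Hu Hv _.
      apply (Rmult_lt_compat_r (4 * r + 1)) in Ht; [|lra].
      unfold Rdiv in Ht; rewrite Rmult_assoc, Rinv_l in Ht by lra.
      specialize (Hd (u, v)); enough (Cmod ((u, v) - (x0, y0))%C < d) by
        (specialize (Hd H); lra).
      eapply Rle_lt_trans; [apply Cmod_Re_Im|]; simpl.
      assert (Rabs (u + - x0) <= t * (2 * r)) by (apply Rabs_le; lra).
      assert (Rabs (v + - y0) <= t * (2 * r)) by (apply Rabs_le; lra).
      lra.
    (* Outside the closed disc, small boxes miss the disc altogether, and any witness will do. *)
    + exists ((Cmod (x0, y0) - r) / (4 * r + 1)); split;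
        [apply Rdiv_lt_0_compat; lra|].
      intros x y t [Ht0 Ht] Hx Hx' Hy Hy'; exists 0%C; split;
        [rewrite Cmod_0; lra|].
      intros u v Hu Hv Huv; exfalso.
      apply (Rmult_lt_compat_r (4 * r + 1)) in Ht; [|lra].
      unfold Rdiv in Ht; rewrite Rmult_assoc, Rinv_l in Ht by lra.
      assert (Rabs (x0 + - u) <= t * (2 * r)) by (apply Rabs_le; lra).
      assert (Rabs (y0 + - v) <= t * (2 * r)) by (apply Rabs_le; lra).
      pose proof (Cmod_Re_Im ((x0, y0) - (u, v))%C) as HH; simpl in HH.
      pose proof (Cmod_le_sub (x0, y0) (u, v)) as HT.
      lra. }
(* The full box contains the disc, hence c itself: the contradiction is [f c < f c]. *)
destruct HP as (c & Hc & H).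
destruct c as [u v].
pose proof (Rmax_Cmod (u, v)) as Hm; simpl in Hm.
pose proof (Rmax_l (Rabs u) (Rabs v)); pose proof (Rmax_r (Rabs u) (Rabs v)).
assert (- r <= u <= r) by (apply Rabs_le_between; lra).
assert (- r <= v <= r) by (apply Rabs_le_between; lra).
specialize (H u v); lra.
Qed.

(** * Goursat's theorem *)

Lemma differentiable_pt_lim_continuous_l (f : R -> R -> R) x y l m :
  differentiable_pt_lim f x y l m -> continuous (fun u => f u y) x.
Proof.
intros H; apply filterlim_locally; intros e.
destruct (differentiable_continuity_pt f x y (ex_intro _ l (ex_intro _ m H)) e)
  as [d Hd].
exists d; intros u Hu; apply Hd; [exact Hu|].
rewrite Rminus_diag, Rabs_R0; apply d.
Qed.

Lemma differentiable_pt_lim_continuous_r (f : R -> R -> R) x y l m :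
  differentiable_pt_lim f x y l m -> continuous (fun v => f x v) y.
Proof.
intros H; apply filterlim_locally; intros e.
destruct (differentiable_continuity_pt f x y (ex_intro _ l (ex_intro _ m H)) e)
  as [d Hd].
exists d; intros v Hv; apply Hd; [|exact Hv].
rewrite Rminus_diag, Rabs_R0; apply d.
Qed.

(* Goursat's theorem for a 1-form A dx + B dy that is closed in the pointwise
   sense: the partial derivatives need not be continuous. *)
Lemma closed_form_box_integral (A B : R -> R -> R) (a b L1 L2 : R) :
  0 <= L1 -> 0 <= L2 ->
  (forall x y, a <= x <= a + L1 -> b <= y <= b + L2 ->
     exists l m n, differentiable_pt_lim A x y l m /\
                   differentiable_pt_lim B x y m n) ->
  RInt (fun x => A x b) a (a + L1) - RInt (fun x => A x (b + L2)) a (a + L1) +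
  RInt (fun y => B (a + L1) y) b (b + L2) - RInt (fun y => B a y) b (b + L2) = 0.
Proof.
intros HL1 HL2 Hd.
set (h := fun y x x' => RInt (fun u => A u y) x x').
set (k := fun x y y' => RInt (fun v => B x v) y y').
assert (exh : forall y x x', b <= y <= b + L2 -> a <= x <= a + L1 -> a <= x' <= a + L1 ->
  ex_RInt (fun u => A u y) x x').
{ intros y x x' Hy Hx Hx'; apply (ex_RInt_continuous (V := R_CompleteNormedModule)).
  intros u Hu; destruct (Hd u y) as (l & m & n & HA & _); auto.
  - pose proof (Rmin_glb x x' a); pose proof (Rmax_lub x x' (a + L1)); lra.
  - exact (differentiable_pt_lim_continuous_l _ _ _ _ _ HA). }
assert (exk : forall x y y', a <= x <= a + L1 -> b <= y <= b + L2 -> b <= y' <= b + L2 ->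
  ex_RInt (fun v => B x v) y y').
{ intros x y y' Hx Hy Hy'; apply (ex_RInt_continuous (V := R_CompleteNormedModule)).
  intros v Hv; destruct (Hd x v) as (l & m & n & _ & HB); auto.
  - pose proof (Rmin_glb y y' b); pose proof (Rmax_lub y y' (b + L2)); lra.
  - exact (differentiable_pt_lim_continuous_r _ _ _ _ _ HB). }
set (J := fun x y t => h y x (x + t * L1) - h (y + t * L2) x (x + t * L1)
  + k (x + t * L1) y (y + t * L2) - k x y (y + t * L2)).
assert (HJ : forall e, 0 < e -> Rabs (J a b 1) <= e).
{ intros e e0.
  (* The bound scales like an area: inner sides cancel and four quarters at (t/2)^2 add up to t^2.
     The premises are the instance at (a, b, 1) of those keeping each subbox inside the region where
     A and B are differentiable. *)
  assert (HP : a <= a -> b <= b -> a + 1 * L1 <= a + L1 -> b + 1 * L2 <= b + L2 ->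
    Rabs (J a b 1) <= e * (1 * 1)).
  2: { rewrite !Rmult_1_r in HP; apply HP; lra. }
  apply (box_bisection L1 L2 a b (fun x y t => a <= x -> b <= y -> x + t * L1 <= a + L1 ->
    y + t * L2 <= b + L2 -> Rabs (J x y t) <= e * (t * t))); auto.
  - intros x y t Ht H1 H2 H3 H4 Hx Hy Hx' Hy'.
    assert (0 <= t / 2 * L1) by (apply Rmult_le_pos; lra).
    assert (0 <= t / 2 * L2) by (apply Rmult_le_pos; lra).
    assert (E1 : t / 2 * L1 + t / 2 * L1 = t * L1) by field.
    assert (E2 : t / 2 * L2 + t / 2 * L2 = t * L2) by field.
    specialize (H1 ltac:(lra) ltac:(lra) ltac:(lra) ltac:(lra)).
    specialize (H2 ltac:(lra) ltac:(lra) ltac:(lra) ltac:(lra)).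
    specialize (H3 ltac:(lra) ltac:(lra) ltac:(lra) ltac:(lra)).
    specialize (H4 ltac:(lra) ltac:(lra) ltac:(lra) ltac:(lra)).
    assert (EJ : J x y t = J x y (t / 2) + J (x + t / 2 * L1) y (t / 2)
      + J x (y + t / 2 * L2) (t / 2) + J (x + t / 2 * L1) (y + t / 2 * L2) (t / 2)).
    { unfold J.
      rewrite <- E1, <- E2, <- !Rplus_assoc.
      set (x1 := x + t / 2 * L1) in *; set (y1 := y + t / 2 * L2) in *.
      set (x2 := x1 + t / 2 * L1) in *; set (y2 := y1 + t / 2 * L2) in *.
      assert (Ch : forall y, b <= y <= b + L2 -> h y x x2 = h y x x1 + h y x1 x2).
      { intros y' ?; symmetry; apply (RInt_Chasles (V := R_CompleteNormedModule));
          apply exh; unfold x2, x1; lra. }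
      assert (Ck : forall x, a <= x <= a + L1 -> k x y y2 = k x y y1 + k x y1 y2).
      { intros x' ?; symmetry; apply (RInt_Chasles (V := R_CompleteNormedModule));
          apply exk; unfold y2, y1; lra. }
      rewrite !Ch, !Ck by (unfold x2, x1, y2, y1; lra); ring. }
    rewrite EJ.
    replace (e * (t * t)) with (e * (t / 2 * (t / 2)) + e * (t / 2 * (t / 2)) +
      e * (t / 2 * (t / 2)) + e * (t / 2 * (t / 2))) by field.
    repeat (eapply Rle_trans; [apply Rabs_triang|]; apply Rplus_le_compat; [|assumption]).
    assumption.
  - intros x0 y0 Hx0 Hy0.
    destruct (Hd x0 y0) as (l & m & n & HA & HB); auto.
    (* Each pair of opposite sides contributes an error of at most tL times 2e'tL, in total
       4e'(tL)^2 = e t^2. The + 1 keeps [L] positive for degenerate boxes. *)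
    set (L := L1 + L2 + 1).
    assert (e1 : 0 < e / (4 * (L * L))) by
      (apply Rdiv_lt_0_compat; auto; unfold L; nra).
    destruct (HA (mkposreal _ e1)) as [d1 H1]; destruct (HB (mkposreal _ e1)) as [d2 H2].
    simpl in H1, H2; set (e' := e / (4 * (L * L))) in *.
    exists (Rmin d1 d2 / L); split.
    { apply Rdiv_lt_0_compat; [apply Rmin_glb_lt; [apply d1|apply d2]|unfold L; lra]. }
    intros x y t [Ht0 Ht] Hx Hx' Hy Hy' _ _ _ _.
    assert (HtL : t * L < Rmin d1 d2).
    { apply (Rmult_lt_compat_r L) in Ht; [|unfold L; lra].
      unfold Rdiv in Ht; rewrite Rmult_assoc, Rinv_l in Ht; unfold L in *; lra. }
    pose proof (Rmin_l d1 d2); pose proof (Rmin_r d1 d2).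
    assert (0 <= t * L1) by nra; assert (0 <= t * L2) by nra.
    assert (TL : t * L = t * L1 + t * L2 + t) by (unfold L; ring).
    assert (near : forall u v, x <= u <= x + t * L1 -> y <= v <= y + t * L2 ->
      Rabs (u - x0) < t * L /\ Rabs (v - y0) < t * L /\
      e' * Rmax (Rabs (u - x0)) (Rabs (v - y0)) <= e' * (t * L)).
    { intros u v Hu Hv.
      assert (Rabs (u - x0) < t * L) by (apply Rabs_lt_between; lra).
      assert (Rabs (v - y0) < t * L) by (apply Rabs_lt_between; lra).
      repeat split; auto; apply Rmult_le_compat_l; [lra|].
      apply Rmax_lub; lra. }
    (* To first order, the horizontal sides give - m (tL1)(tL2) and the vertical ones + m
       (tL1)(tL2). The common value m of dA/dy and dB/dx makes them cancel. *)
    assert (GA : forall u, x <= u <= x + t * L1 ->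
      Rabs (A u y - A u (y + t * L2) + m * (t * L2)) <= 2 * (e' * (t * L))).
    { intros u Hu.
      destruct (near u y) as (N1 & N2 & N3); [lra|lra|].
      destruct (near u (y + t * L2)) as (M1 & M2 & M3); [lra|lra|].
      specialize (H1 u y ltac:(lra) ltac:(lra)) as K1.
      specialize (H1 u (y + t * L2) ltac:(lra) ltac:(lra)) as K2.
      apply Rabs_le_between in K1; apply Rabs_le_between in K2.
      apply Rabs_le; lra. }
    assert (GB : forall v, y <= v <= y + t * L2 ->
      Rabs (B (x + t * L1) v - B x v - m * (t * L1)) <= 2 * (e' * (t * L))).
    { intros v Hv.
      destruct (near x v) as (N1 & N2 & N3); [lra|lra|].
      destruct (near (x + t * L1) v) as (M1 & M2 & M3); [lra|lra|].
      specialize (H2 x v ltac:(lra) ltac:(lra)) as K1.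
      specialize (H2 (x + t * L1) v ltac:(lra) ltac:(lra)) as K2.
      apply Rabs_le_between in K1; apply Rabs_le_between in K2.
      apply Rabs_le; lra. }
    assert (IA : is_RInt (fun u => A u y - A u (y + t * L2) + m * (t * L2)) x (x + t * L1)
      (h y x (x + t * L1) - h (y + t * L2) x (x + t * L1) + t * L1 * (m * (t * L2)))).
    { apply (is_RInt_plus (V := R_NormedModule)); [apply (is_RInt_minus (V := R_NormedModule))|].
      - apply (RInt_correct (V := R_CompleteNormedModule)), exh; lra.
      - apply (RInt_correct (V := R_CompleteNormedModule)), exh; lra.
      - replace (t * L1) with (x + t * L1 - x) at 2 by ring.
        apply (is_RInt_const (V := R_NormedModule)). }
    assert (IB : is_RInt (fun v => B (x + t * L1) v - B x v - m * (t * L1)) y (y + t * L2)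
      (k (x + t * L1) y (y + t * L2) - k x y (y + t * L2) - t * L2 * (m * (t * L1)))).
    { apply (is_RInt_minus (V := R_NormedModule)); [apply (is_RInt_minus (V := R_NormedModule))|].
      - apply (RInt_correct (V := R_CompleteNormedModule)), exk; lra.
      - apply (RInt_correct (V := R_CompleteNormedModule)), exk; lra.
      - replace (t * L2) with (y + t * L2 - y) at 2 by ring.
        apply (is_RInt_const (V := R_NormedModule)). }
    pose proof (abs_RInt_le_const _ x (x + t * L1) _ ltac:(lra) (ex_intro _ _ IA) GA) as BA.
    pose proof (abs_RInt_le_const _ y (y + t * L2) _ ltac:(lra) (ex_intro _ _ IB) GB) as BB.
    rewrite (is_RInt_unique _ _ _ _ IA) in BA; rewrite (is_RInt_unique _ _ _ _ IB) in BB.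
    assert (Ee : e * (t * t) = 2 * (2 * (e' * (t * L)) * (t * L))).
    { unfold e'; field; unfold L; lra. }
    assert (0 <= 2 * (e' * (t * L))) by nra.
    assert ((x + t * L1 - x) * (2 * (e' * (t * L))) <= (2 * (e' * (t * L))) * (t * L)).
    { rewrite Rmult_comm; apply Rmult_le_compat_l; lra. }
    assert ((y + t * L2 - y) * (2 * (e' * (t * L))) <= (2 * (e' * (t * L))) * (t * L)).
    { rewrite Rmult_comm; apply Rmult_le_compat_l; lra. }
    rewrite Ee; unfold J.
    apply Rabs_le_between in BA; apply Rabs_le_between in BB; apply Rabs_le; lra. }
assert (J0 : J a b 1 = 0).
{ destruct (Req_dec (J a b 1) 0) as [|Hne]; auto.
  pose proof (Rabs_pos_lt _ Hne); specialize (HJ (Rabs (J a b 1) / 2)); lra. }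
unfold J, h, k in J0; rewrite !Rmult_1_l in J0; exact J0.
Qed.

(** * Complex derivatives *)

(** Little-o form with an explicit derivative, convenient for passing both to real differentiability
    of the components and to Fréchet differentiability. *)
Definition C_deriv_at (f : C -> C) (z d : C) : Prop :=
  forall e, 0 < e -> exists r, 0 < r /\
  forall w, Cmod (w - z)%C < r ->
    Cmod (f w - f z - d * (w - z))%C <= e * Cmod (w - z)%C.

Definition C_continuous_at (f : C -> C) (z : C) : Prop :=
  forall e, 0 < e -> exists r, 0 < r /\
  forall w, Cmod (w - z)%C < r -> Cmod (f w - f z)%C < e.

Lemma C_deriv_at_lipschitz (f : C -> C) (z d : C) :
  C_deriv_at f z d -> exists r, 0 < r /\
  forall w, Cmod (w - z)%C < r ->
    Cmod (f w - f z)%C <= (Cmod d + 1) * Cmod (w - z)%C.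
Proof.
intros H; destruct (H 1) as (r & r0 & Hr); [lra|].
exists r; split; auto; intros w Hw; specialize (Hr w Hw).
pose proof (Cmod_le_sub (f w - f z) (d * (w - z))) as T.
rewrite Cmod_mult in T; lra.
Qed.

Lemma C_deriv_at_continuous (f : C -> C) (z d : C) :
  C_deriv_at f z d -> C_continuous_at f z.
Proof.
intros H e e0; destruct (C_deriv_at_lipschitz _ _ _ H) as (r & r0 & Hr).
pose proof (Cmod_ge_0 d) as d0.
exists (Rmin r (e / (Cmod d + 1))); split.
{ apply Rmin_glb_lt; auto; apply Rdiv_lt_0_compat; lra. }
intros w Hw; pose proof (Rmin_l r (e / (Cmod d + 1)));
  pose proof (Rmin_r r (e / (Cmod d + 1))).
specialize (Hr w ltac:(lra)).
assert (Hw' : Cmod (w - z)%C < e / (Cmod d + 1)) by lra.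
apply (Rmult_lt_compat_l (Cmod d + 1)) in Hw'; [|lra].
replace ((Cmod d + 1) * (e / (Cmod d + 1))) with e in Hw' by (field; lra); lra.
Qed.

Lemma C_deriv_at_ext_loc (f g : C -> C) (z d : C) (r : R) :
  0 < r -> (forall w, Cmod (w - z)%C < r -> f w = g w) ->
  C_deriv_at f z d -> C_deriv_at g z d.
Proof.
intros r0 Hfg H e e0; destruct (H e e0) as (s & s0 & Hs).
exists (Rmin r s); split; [now apply Rmin_glb_lt|].
intros w Hw; pose proof (Rmin_l r s); pose proof (Rmin_r r s).
rewrite <- !Hfg; [apply Hs; lra| |lra].
replace (z - z)%C with (RtoC 0) by ring; now rewrite Cmod_0.
Qed.

Lemma C_deriv_at_const (a z : C) : C_deriv_at (fun _ => a) z 0%C.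
Proof.
intros e e0; exists 1; split; [lra|]; intros w _.
replace (a - a - 0 * (w - z))%C with (RtoC 0) by ring.
rewrite Cmod_0; apply Rmult_le_pos; [lra|apply Cmod_ge_0].
Qed.

Lemma C_deriv_at_id (z : C) : C_deriv_at (fun w => w) z 1%C.
Proof.
intros e e0; exists 1; split; [lra|]; intros w _.
replace (w - z - 1 * (w - z))%C with (RtoC 0) by ring.
rewrite Cmod_0; apply Rmult_le_pos; [lra|apply Cmod_ge_0].
Qed.

Lemma C_deriv_at_plus (f g : C -> C) (z a b : C) :
  C_deriv_at f z a -> C_deriv_at g z b ->
  C_deriv_at (fun w => f w + g w)%C z (a + b)%C.
Proof.
intros Hf Hg e e0.
destruct (Hf (e / 2)) as (r & r0 & Hr); [lra|].
destruct (Hg (e / 2)) as (s & s0 & Hs); [lra|].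
exists (Rmin r s); split; [now apply Rmin_glb_lt|].
intros w Hw; pose proof (Rmin_l r s); pose proof (Rmin_r r s).
specialize (Hr w ltac:(lra)); specialize (Hs w ltac:(lra)).
replace (f w + g w - (f z + g z) - (a + b) * (w - z))%C
  with ((f w - f z - a * (w - z)) + (g w - g z - b * (w - z)))%C by ring.
eapply Rle_trans; [apply Cmod_triangle|lra].
Qed.

Lemma C_deriv_at_comp (f g : C -> C) (z a b : C) :
  C_deriv_at f z a -> C_deriv_at g (f z) b ->
  C_deriv_at (fun w => g (f w)) z (b * a)%C.
Proof.
intros Hf Hg e e0.
pose proof (Cmod_ge_0 a) as a0; pose proof (Cmod_ge_0 b) as b0.
destruct (C_deriv_at_lipschitz _ _ _ Hf) as (r1 & r10 & L).
destruct (Hf (e / (2 * (Cmod b + 1)))) as (r2 & r20 & H2);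
  [apply Rdiv_lt_0_compat; lra|].
destruct (Hg (e / (2 * (Cmod a + 1)))) as (s & s0 & H3);
  [apply Rdiv_lt_0_compat; lra|].
destruct (C_deriv_at_continuous _ _ _ Hf s s0) as (r3 & r30 & H4).
exists (Rmin r1 (Rmin r2 r3)); split; [now repeat apply Rmin_glb_lt|].
intros w Hw.
pose proof (Rmin_l r1 (Rmin r2 r3)); pose proof (Rmin_r r1 (Rmin r2 r3)).
pose proof (Rmin_l r2 r3); pose proof (Rmin_r r2 r3).
specialize (L w ltac:(lra)); specialize (H2 w ltac:(lra)).
specialize (H4 w ltac:(lra)); specialize (H3 _ H4).
replace (g (f w) - g (f z) - b * a * (w - z))%C
  with ((g (f w) - g (f z) - b * (f w - f z)) + b * (f w - f z - a * (w - z)))%C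
  by ring.
eapply Rle_trans; [apply Cmod_triangle|]; rewrite Cmod_mult.
set (W := Cmod (w - z)%C) in *; assert (W0 : 0 <= W) by apply Cmod_ge_0.
assert (e / (2 * (Cmod a + 1)) * Cmod (f w - f z)%C <= e / 2 * W).
{ replace (e / 2 * W) with (e / (2 * (Cmod a + 1)) * ((Cmod a + 1) * W))
    by (field; lra).
  apply Rmult_le_compat_l; auto; left; apply Rdiv_lt_0_compat; lra. }
assert (Cmod b * Cmod (f w - f z - a * (w - z))%C <= e / 2 * W).
{ replace (e / 2 * W) with ((Cmod b + 1) * (e / (2 * (Cmod b + 1)) * W))
    by (field; lra).
  apply Rmult_le_compat; auto; try apply Cmod_ge_0; lra. }
lra.
Qed.

Lemma C_deriv_at_square (z : C) : C_deriv_at (fun w => w * w)%C z (2 * z)%C.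
Proof.
intros e e0; exists e; split; auto; intros w Hw.
replace (w * w - z * z - 2 * z * (w - z))%C with ((w - z) * (w - z))%C by ring.
rewrite Cmod_mult; apply Rmult_le_compat_r; [apply Cmod_ge_0|lra].
Qed.

Lemma C_deriv_at_scal (f : C -> C) (z a c : C) :
  C_deriv_at f z a -> C_deriv_at (fun w => c * f w)%C z (c * a)%C.
Proof.
intros H; apply (C_deriv_at_comp f (fun w => c * w)%C); auto.
intros e e0; exists 1; split; [lra|]; intros w _.
replace (c * w - c * f z - c * (w - f z))%C with (RtoC 0) by ring.
rewrite Cmod_0; apply Rmult_le_pos; [lra|apply Cmod_ge_0].
Qed.

(* Polarisation: 2 f g = (f + g)^2 - f^2 - g^2. *)
Lemma C_deriv_at_mult (f g : C -> C) (z a b : C) :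
  C_deriv_at f z a -> C_deriv_at g z b ->
  C_deriv_at (fun w => f w * g w)%C z (a * g z + f z * b)%C.
Proof.
intros Hf Hg.
assert (Hsq : forall h c, C_deriv_at h z c ->
  C_deriv_at (fun w => h w * h w)%C z (2 * h z * c)%C).
{ intros h c Hh; exact (C_deriv_at_comp _ _ _ _ _ Hh (C_deriv_at_square _)). }
pose proof (C_deriv_at_plus _ _ _ _ _ (Hsq _ _ (C_deriv_at_plus _ _ _ _ _ Hf Hg))
  (C_deriv_at_plus _ _ _ _ _ (C_deriv_at_scal _ _ _ (- (1))%C (Hsq _ _ Hf))
     (C_deriv_at_scal _ _ _ (- (1))%C (Hsq _ _ Hg)))) as H.
apply (C_deriv_at_scal _ _ _ (/ 2)%C) in H.
assert (H2 : RtoC 2 <> 0%C) by (intros H2; apply RtoC_inj in H2; lra).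
match type of H with C_deriv_at _ _ ?d =>
  replace (a * g z + f z * b)%C with d by (field; exact H2) end.
revert H; apply (C_deriv_at_ext_loc _ _ _ _ 1); [lra|].
intros w _; field; exact H2.
Qed.

Lemma C_deriv_at_inv (z : C) :
  z <> 0%C -> C_deriv_at (fun w => / w)%C z (- (/ (z * z)))%C.
Proof.
intros Hz e e0; assert (z0 : 0 < Cmod z) by now apply Cmod_gt_0.
set (m := Cmod z) in *.
(* The remainder is (w - z)^2 / (w z^2), of modulus at most 2 |w - z|^2 / m^3 once |w| > m/2. *)
exists (Rmin (m / 2) (e * (m * m * m) / 2)); split.
{ apply Rmin_glb_lt; [lra|]; apply Rdiv_lt_0_compat; [|lra].
  repeat apply Rmult_lt_0_compat; auto. }
intros w Hw.
pose proof (Rmin_l (m / 2) (e * (m * m * m) / 2)).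
pose proof (Rmin_r (m / 2) (e * (m * m * m) / 2)).
assert (Hwm : m / 2 < Cmod w).
{ pose proof (Cmod_le_sub z w) as T.
  replace (z - w)%C with (- (w - z))%C in T by ring; rewrite Cmod_opp in T.
  fold m in T; lra. }
assert (Hw0 : w <> 0%C) by (apply Cmod_gt_0; lra).
replace (/ w - / z - - / (z * z) * (w - z))%C
  with ((w - z) * ((w - z) * / (w * (z * z))))%C by (field; auto).
assert (w * (z * z) <> 0)%C by (repeat apply Cmult_neq_0; auto).
rewrite !Cmod_mult, Cmod_inv, !Cmod_mult by auto; fold m.
set (W := Cmod (w - z)%C) in *; assert (W0 : 0 <= W) by apply Cmod_ge_0.
rewrite Rmult_comm; apply Rmult_le_compat_r; auto.
assert (P : 0 < Cmod w * (m * m)) by (repeat apply Rmult_lt_0_compat; lra).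
apply (Rmult_le_reg_r (Cmod w * (m * m))); auto.
rewrite Rmult_assoc, Rinv_l, Rmult_1_r by lra.
assert (e * (m * m) * (m / 2) <= e * (m * m) * Cmod w).
{ apply Rmult_le_compat_l; [|lra]; left; repeat apply Rmult_lt_0_compat; auto. }
lra.
Qed.

Lemma C_deriv_at_differentiable_pt_lim (f : C -> C) (x y : R) (d : C) :
  C_deriv_at f (x, y) d ->
  differentiable_pt_lim (fun u v => fst (f (u, v))) x y (fst d) (- snd d) /\
  differentiable_pt_lim (fun u v => snd (f (u, v))) x y (snd d) (fst d).
Proof.
intros H.
assert (K : forall e : posreal, locally_2d (fun u v =>
  Cmod (f (u, v) - f (x, y) - d * ((u, v) - (x, y)))%C <=
    e * Rmax (Rabs (u - x)) (Rabs (v - y))) x y).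
{ intros e; destruct (H (e / 2)) as (r & r0 & Hr);
    [apply is_pos_div_2|].
  assert (r2 : 0 < r / 2) by lra.
  exists (mkposreal _ r2); simpl; intros u v Hu Hv.
  pose proof (Cmod_Re_Im ((u, v) - (x, y))%C) as T; simpl in T.
  fold (u - x) in T; fold (v - y) in T.
  eapply Rle_trans; [apply Hr; lra|].
  pose proof (Rmax_l (Rabs (u - x)) (Rabs (v - y))).
  pose proof (Rmax_r (Rabs (u - x)) (Rabs (v - y))).
  pose proof (cond_pos e).
  apply Rle_trans with (e / 2 * (2 * Rmax (Rabs (u - x)) (Rabs (v - y)))); [|lra].
  apply Rmult_le_compat_l; lra. }
split; intros e; destruct (K e) as [r Hr]; exists r; intros u v Hu Hv;
  (eapply Rle_trans; [|apply (Hr u v Hu Hv)]);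
  pose proof (Rmax_Cmod (f (u, v) - f (x, y) - d * ((u, v) - (x, y)))%C) as T.
- eapply Rle_trans; [|eapply Rle_trans; [apply Rmax_l|exact T]].
  apply Req_le, f_equal; simpl; ring.
- eapply Rle_trans; [|eapply Rle_trans; [apply Rmax_r|exact T]].
  apply Req_le, f_equal; simpl; ring.
Qed.

(** Joint differentiability of the components, more than existence of partial derivatives, makes the
    Cauchy-Riemann equations sufficient. This is how [Cexp] and [Clog] get their derivatives. *)
Lemma cauchy_riemann_C_deriv_at (f : C -> C) (x y a b : R) :
  differentiable_pt_lim (fun u v => fst (f (u, v))) x y a (- b) ->
  differentiable_pt_lim (fun u v => snd (f (u, v))) x y b a ->
  C_deriv_at f (x, y) (a, b).
Proof.
intros H1 H2 e e0; assert (e2 : 0 < e / 2) by lra.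
destruct (H1 (mkposreal _ e2)) as [r1 K1]; destruct (H2 (mkposreal _ e2)) as [r2 K2].
exists (Rmin r1 r2); split; [apply Rmin_glb_lt; [apply r1|apply r2]|].
intros [u v] Hw; pose proof (Rmin_l r1 r2); pose proof (Rmin_r r1 r2).
pose proof (Rmax_Cmod ((u, v) - (x, y))%C) as T; simpl in T, K1, K2.
fold (u - x) in T; fold (v - y) in T.
pose proof (Rmax_l (Rabs (u - x)) (Rabs (v - y))).
pose proof (Rmax_r (Rabs (u - x)) (Rabs (v - y))).
specialize (K1 u v ltac:(lra) ltac:(lra)); specialize (K2 u v ltac:(lra) ltac:(lra)).
eapply Rle_trans; [apply Cmod_Re_Im|].
assert (M : e / 2 * Rmax (Rabs (u - x)) (Rabs (v - y)) <=
  e / 2 * Cmod ((u, v) - (x, y))%C) by (apply Rmult_le_compat_l; lra).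
replace (e * Cmod ((u, v) - (x, y))%C) with
  (e / 2 * Cmod ((u, v) - (x, y))%C + e / 2 * Cmod ((u, v) - (x, y))%C) by field.
apply Rplus_le_compat; (eapply Rle_trans; [|exact M]).
- eapply Rle_trans; [|exact K1]; apply Req_le, f_equal; simpl; ring.
- eapply Rle_trans; [|exact K2]; apply Req_le, f_equal; simpl; ring.
Qed.

(** * Complex exponential and powers *)

Lemma differentiable_pt_lim_snd (x y : R) :
  differentiable_pt_lim (fun _ v => v) x y 0 1.
Proof.
intros e; exists (mkposreal 1 Rlt_0_1); intros u v _ _.
replace (v - y - _) with 0 by ring; rewrite Rabs_R0.
apply Rmult_le_pos; [left; apply e|].
eapply Rle_trans; [apply Rabs_pos|apply Rmax_l].
Qed.

Lemma differentiable_pt_lim_plus (x y : R) :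
  differentiable_pt_lim (fun u v => u + v) x y 1 1.
Proof.
intros e; exists (mkposreal 1 Rlt_0_1); intros u v _ _.
replace (u + v - (x + y) - _) with 0 by ring; rewrite Rabs_R0.
apply Rmult_le_pos; [left; apply e|].
eapply Rle_trans; [apply Rabs_pos|apply Rmax_l].
Qed.

Lemma differentiable_pt_lim_mult (x y : R) :
  differentiable_pt_lim (fun u v => u * v) x y y x.
Proof.
intros e; exists e; intros u v Hu Hv.
replace (u * v - x * y - _) with ((u - x) * (v - y)) by ring.
rewrite Rabs_mult; apply Rmult_le_compat; try apply Rabs_pos; [lra|apply Rmax_r].
Qed.

Lemma differentiable_pt_lim_of_fst (f : R -> R) (x y l : R) :
  is_derive f x l -> differentiable_pt_lim (fun u _ => f u) x y l 0.
Proof.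
intros H; apply differentiable_pt_lim_proj1_0, is_derive_Reals, H.
Qed.

Lemma differentiable_pt_lim_comp_1d (f : R -> R) (g : R -> R -> R) (x y l a b : R) :
  is_derive f (g x y) l -> differentiable_pt_lim g x y a b ->
  differentiable_pt_lim (fun u v => f (g u v)) x y (l * a) (l * b).
Proof.
intros Hf Hg.
replace (l * a) with (l * a + 0 * a) by ring.
replace (l * b) with (l * b + 0 * b) by ring.
apply (differentiable_pt_lim_comp (fun u _ => f u) g g); auto.
now apply differentiable_pt_lim_of_fst.
Qed.

Definition Cexp (z : C) : C := (exp (fst z) * cos (snd z), exp (fst z) * sin (snd z)).

Lemma Cmod_Cexp (z : C) : Cmod (Cexp z) = exp (fst z).
Proof.
pose proof (exp_pos (fst z)) as Hp; unfold Cmod, Cexp; simpl.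
transitivity (sqrt (Rsqr (exp (fst z)))); [f_equal|apply sqrt_Rsqr; lra].
pose proof (sin2_cos2 (snd z)) as H; unfold Rsqr in *.
transitivity (exp (fst z) * exp (fst z) *
  (sin (snd z) * sin (snd z) + cos (snd z) * cos (snd z)));
  [ring|rewrite H; ring].
Qed.

Lemma C_deriv_at_Cexp (z : C) : C_deriv_at Cexp z (Cexp z).
Proof.
destruct z as [x y]; unfold Cexp; simpl.
assert (He : differentiable_pt_lim (fun u _ => exp u) x y (exp x) 0).
{ apply differentiable_pt_lim_of_fst; auto_derive; auto; ring. }
assert (Hc : differentiable_pt_lim (fun _ v => cos v) x y (- sin y * 0) (- sin y * 1)).
{ apply (differentiable_pt_lim_comp_1d cos (fun _ v => v)).
  - auto_derive; auto; ring.
  - apply differentiable_pt_lim_snd. }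
assert (Hs : differentiable_pt_lim (fun _ v => sin v) x y (cos y * 0) (cos y * 1)).
{ apply (differentiable_pt_lim_comp_1d sin (fun _ v => v)).
  - auto_derive; auto; ring.
  - apply differentiable_pt_lim_snd. }
apply cauchy_riemann_C_deriv_at; simpl.
- pose proof (differentiable_pt_lim_comp _ _ _ _ _ _ _ _ _ _ _
    (differentiable_pt_lim_mult (exp x) (cos y)) He Hc) as H.
  match type of H with differentiable_pt_lim _ _ _ ?a ?b =>
    replace a with (exp x * cos y) in H by ring;
    replace b with (- (exp x * sin y)) in H by ring end.
  exact H.
- pose proof (differentiable_pt_lim_comp _ _ _ _ _ _ _ _ _ _ _
    (differentiable_pt_lim_mult (exp x) (sin y)) He Hs) as H.
  match type of H with differentiable_pt_lim _ _ _ ?a ?b =>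
    replace a with (exp x * sin y) in H by ring;
    replace b with (exp x * cos y) in H by ring end.
  exact H.
Qed.

(* Principal branch, meaningful only where the real part is positive. *)
Definition Clog (z : C) : C :=
  (ln (fst z * fst z + snd z * snd z) / 2, atan (snd z * / fst z)).

Lemma C_deriv_at_Clog (z : C) : 0 < fst z -> C_deriv_at Clog z (/ z)%C.
Proof.
destruct z as [x y]; simpl; intros Hx; unfold Clog, Cinv; simpl.
assert (P : 0 < x * x + y * y) by nra.
assert (Hxx : differentiable_pt_lim (fun u _ => u * u) x y (2 * x) 0).
{ apply differentiable_pt_lim_of_fst; auto_derive; auto; ring. }
assert (Hyy : differentiable_pt_lim (fun _ v => v * v) x y (2 * y * 0) (2 * y * 1)).
{ apply (differentiable_pt_lim_comp_1d (fun v => v * v) (fun _ v => v)).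
  - auto_derive; auto; ring.
  - apply differentiable_pt_lim_snd. }
assert (Hi : differentiable_pt_lim (fun u _ => / u) x y (- (/ (x * x))) 0).
{ apply differentiable_pt_lim_of_fst; auto_derive; [lra|field; lra]. }
apply cauchy_riemann_C_deriv_at; simpl.
- assert (Hl : is_derive (fun a => ln a / 2) (x * x + y * y)
    (/ (2 * (x * x + y * y)))) by (auto_derive; [lra|field; lra]).
  pose proof (differentiable_pt_lim_comp_1d (fun a => ln a / 2) _ _ _ _ _ _ Hl
    (differentiable_pt_lim_comp _ _ _ _ _ _ _ _ _ _ _
    (differentiable_pt_lim_plus (x * x) (y * y)) Hxx Hyy)) as H.
  simpl in H.
  match type of H with differentiable_pt_lim _ _ _ ?a ?b =>
    replace a with (x / (x * (x * 1) + y * (y * 1))) in H by (field; lra);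
    replace b with (- (- y / (x * (x * 1) + y * (y * 1)))) in H by (field; lra) end.
  exact H.
- assert (Ht : 1 + (y * / x) * (y * / x) <> 0) by nra.
  assert (Ha : is_derive atan (y * / x) (/ (1 + (y * / x) * (y * / x)))).
  { auto_derive; auto; field; split; lra. }
  pose proof (differentiable_pt_lim_comp_1d atan _ _ _ _ _ _ Ha
    (differentiable_pt_lim_comp _ _ _ _ _ _ _ _ _ _ _
    (differentiable_pt_lim_mult y (/ x)) (differentiable_pt_lim_snd x y) Hi)) as H.
  simpl in H.
  match type of H with differentiable_pt_lim _ _ _ ?a ?b =>
    replace a with (- y / (x * (x * 1) + y * (y * 1))) in H by (field; repeat split; lra);
    replace b with (x / (x * (x * 1) + y * (y * 1))) in H by (field; repeat split; lra) end.
  exact H.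
Qed.

Definition Cpower (z : C) (s : R) : C := Cexp (s * Clog z)%C.

Lemma C_deriv_at_Cpower (z : C) (s : R) :
  0 < fst z -> exists d, C_deriv_at (fun w => Cpower w s) z d.
Proof.
intros Hz; eexists; unfold Cpower.
apply (C_deriv_at_comp (fun w => s * Clog w)%C Cexp).
- apply C_deriv_at_scal, C_deriv_at_Clog, Hz.
- apply C_deriv_at_Cexp.
Qed.

(** For a real exponent the argument of z affects only the phase. The form with |z|^2 and s/2
    matches the real part of [Clog], so no square root has to be simplified. *)
Lemma Cmod_Cpower (z : C) (s : R) :
  Cmod (Cpower z s) = Rpower (Cmod z ^ 2) (s / 2).
Proof.
unfold Cpower; rewrite Cmod_Cexp, Cmod2_alt; unfold Clog, Rpower, Re, Im; simpl.
f_equal; rewrite !Rmult_1_r; field.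
Qed.

Lemma Cpower_pos_real (x s : R) : 0 < x -> Cpower x s = Cmod (Cpower x s).
Proof.
intros Hx; unfold Cpower; rewrite Cmod_Cexp; unfold Cexp, Clog, RtoC; simpl.
replace (s * atan (0 * / x) + 0 * (ln (x * x + 0 * 0) / 2)) with 0
  by (rewrite Rmult_0_l, atan_0; ring).
rewrite cos_0, sin_0, Rmult_1_r; f_equal; ring.
Qed.

(** * Maximum modulus and Schwarz estimate *)

(* In the coordinate z with w = c + exp z, the punctured disc becomes a strip on
   which q is periodic; Goursat's theorem on a period shows that the mean of q
   on circles about c does not depend on the radius, so it equals q c. *)
Lemma circle_Re_le (q : C -> C) (c : C) (r R m : R) :
  0 < r < R ->
  (forall w, 0 < Cmod (w - c)%C < R -> exists d, C_deriv_at q w d) ->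
  C_continuous_at q c ->
  (forall w, Cmod (w - c)%C = r -> fst (q w) <= m) ->
  fst (q c) <= m.
Proof.
intros [r0 rR] Hq Hc Hm; apply Rnot_lt_le; intros Hlt.
(* No limit of means is taken: on a circle of radius r' < d, Re q exceeds the midpoint of m and Re
   (q c), while its mean on the circle of radius r is at most m. *)
destruct (Hc ((fst (q c) - m) / 2)) as (d & d0 & Hd); [lra|].
set (r' := Rmin r (d / 2)).
assert (Hr' : 0 < r') by (apply Rmin_glb_lt; lra).
pose proof (Rmin_l r (d / 2)) as Hr'1; pose proof (Rmin_r r (d / 2)) as Hr'2.
fold r' in Hr'1, Hr'2.
assert (Hln : ln r' <= ln r) by (apply ln_le; auto).
set (G := fun z => q (c + Cexp z)%C).
assert (circ : forall z, Cmod (c + Cexp z - c)%C = exp (fst z)).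
{ intros z; rewrite <- Cmod_Cexp; f_equal; ring. }
assert (Gd : forall z, fst z <= ln r -> exists l, C_deriv_at G z l).
{ intros z Hz; destruct (Hq (c + Cexp z)%C) as [l Hl].
  - rewrite circ; split; [apply exp_pos|].
    apply Rle_lt_trans with (2 := rR).
    rewrite <- (exp_ln r) by auto; destruct Hz as [Hz| ->]; [|apply Rle_refl].
    left; now apply exp_increasing.
  - eexists; apply (C_deriv_at_comp (fun z => c + Cexp z)%C q); [|exact Hl].
    apply C_deriv_at_plus; [apply C_deriv_at_const|apply C_deriv_at_Cexp]. }
assert (pi0 := PI_RGT_0).
assert (ex : forall x, x <= ln r -> ex_RInt (fun y => fst (G (x, y))) 0 (0 + 2 * PI)).
{ intros x Hx; apply (ex_RInt_continuous (V := R_CompleteNormedModule)); intros y _.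
  destruct (Gd (x, y) Hx) as [l Hl].
  destruct (C_deriv_at_differentiable_pt_lim _ _ _ _ Hl) as [H _].
  exact (differentiable_pt_lim_continuous_r _ _ _ _ _ H). }
assert (const : forall a, is_RInt (fun _ => a) 0 (0 + 2 * PI) (2 * PI * a)).
{ intros a; replace (2 * PI * a) with (scal (0 + 2 * PI - 0) a)
    by (unfold scal; simpl; unfold mult; simpl; ring).
  apply (is_RInt_const (V := R_NormedModule)). }
(* This is the form Im (G dz): Cauchy-Riemann says that it is closed, and its dy coefficient is the
   quantity averaged over circles. *)
pose proof (closed_form_box_integral (fun x y => snd (G (x, y)))
  (fun x y => fst (G (x, y))) (ln r') 0 (ln r - ln r') (2 * PI)
  ltac:(lra) ltac:(lra)) as H.
rewrite (RInt_ext (fun x => snd (G (x, 0 + 2 * PI))) (fun x => snd (G (x, 0)))) in H.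
2: { intros x _; unfold G, Cexp; simpl.
     now rewrite Rplus_0_l, cos_2PI, sin_2PI, cos_0, sin_0. }
replace (ln r' + (ln r - ln r')) with (ln r) in H by ring.
assert (L1 : RInt (fun y => fst (G (ln r, y))) 0 (0 + 2 * PI) <= 2 * PI * m).
{ rewrite <- (is_RInt_unique _ _ _ _ (const m)).
  apply RInt_le; [lra|apply ex; lra|eexists; apply const|].
  intros y _; apply Hm; rewrite circ; simpl; now rewrite exp_ln. }
assert (L2 : 2 * PI * ((fst (q c) + m) / 2) <=
  RInt (fun y => fst (G (ln r', y))) 0 (0 + 2 * PI)).
{ rewrite <- (is_RInt_unique _ _ _ _ (const _)).
  apply RInt_le; [lra|eexists; apply const|apply ex; lra|].
  intros y _; unfold G.
  specialize (Hd (c + Cexp (ln r', y))%C).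
  rewrite circ in Hd; simpl in Hd; rewrite exp_ln in Hd by auto.
  specialize (Hd ltac:(lra)).
  pose proof (re_le_Cmod (q (c + Cexp (ln r', y)) - q c)%C) as K.
  unfold Re in K; simpl in K; apply Rabs_le_between in K; lra. }
assert (2 * PI * m < 2 * PI * ((fst (q c) + m) / 2)) by
  (apply Rmult_lt_compat_l; lra).
cut (forall x y, ln r' <= x <= ln r -> 0 <= y <= 0 + 2 * PI -> exists l m n,
  differentiable_pt_lim (fun x y => snd (G (x, y))) x y l m /\
  differentiable_pt_lim (fun x y => fst (G (x, y))) x y m n).
- intros Hdiff; specialize (H Hdiff); lra.
- intros x y Hx _; destruct (Gd (x, y)) as [l Hl]; [apply Hx|].
  destruct (C_deriv_at_differentiable_pt_lim _ _ _ _ Hl).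
  now exists (snd l), (fst l), (- snd l).
Qed.

Lemma C_continuous_at_plus (f g : C -> C) (z : C) :
  C_continuous_at f z -> C_continuous_at g z ->
  C_continuous_at (fun w => f w + g w)%C z.
Proof.
intros Hf Hg e e0.
destruct (Hf (e / 2)) as (r & r0 & Hr); [lra|].
destruct (Hg (e / 2)) as (s & s0 & Hs); [lra|].
exists (Rmin r s); split; [now apply Rmin_glb_lt|].
intros w Hw; pose proof (Rmin_l r s); pose proof (Rmin_r r s).
specialize (Hr w ltac:(lra)); specialize (Hs w ltac:(lra)).
replace (f w + g w - (f z + g z))%C with ((f w - f z) + (g w - g z))%C by ring.
eapply Rle_lt_trans; [apply Cmod_triangle|lra].
Qed.

Lemma C_continuous_at_scal (f : C -> C) (z c : C) :
  C_continuous_at f z -> C_continuous_at (fun w => c * f w)%C z.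
Proof.
intros Hf e e0; pose proof (Cmod_ge_0 c) as c0.
destruct (Hf (e / (Cmod c + 1))) as (r & r0 & Hr); [apply Rdiv_lt_0_compat; lra|].
exists r; split; auto; intros w Hw; specialize (Hr w Hw).
replace (c * f w - c * f z)%C with (c * (f w - f z))%C by ring; rewrite Cmod_mult.
apply (Rmult_lt_compat_l (Cmod c + 1)) in Hr; [|lra].
replace ((Cmod c + 1) * (e / (Cmod c + 1))) with e in Hr by (field; lra).
pose proof (Cmod_ge_0 (f w - f z)%C); lra.
Qed.

(* At an interior maximum c of |k|^2 + e |w|^2, the real part of
   w |-> conj (k c) k w + e conj c (w - c) is at most |k c|^2 - e r^2 / 2 on
   the circle of radius r about c, but equals |k c|^2 at c. *)
Lemma max_modulus_disc (k : C -> C) (R M : R) :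
  0 < R -> 0 <= M ->
  (forall w, Cmod w <= R -> C_continuous_at k w) ->
  (forall w : C, w <> 0%C -> Cmod w < R -> exists d, C_deriv_at k w d) ->
  (forall w, Cmod w = R -> Cmod (k w) <= M) ->
  forall w, Cmod w <= R -> Cmod (k w) <= M.
Proof.
intros HR HM Hc Hd Hb w0 Hw0.
assert (He : forall e, 0 < e -> Cmod (k w0) ^ 2 <= M ^ 2 + e * R ^ 2).
{ intros e e0.
  destruct (disc_max_attained R (fun w => Cmod (k w) ^ 2 + e * Cmod w ^ 2))
    as (c & HcR & Hmax); [lra| |].
  { intros z Hz e' e'0.
    set (a := Cmod (k z)); set (b := Cmod z).
    assert (a0 : 0 <= a) by apply Cmod_ge_0; assert (b0 : 0 <= b) by apply Cmod_ge_0.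
    (* For t <= 1, a modulus a that grows by at most t has its square grow by at most t (2a + 1);
       likewise for b. *)
    set (t := Rmin 1 (e' / (2 * a + 1 + e * (2 * b + 1)))).
    assert (Hden : 0 < 2 * a + 1 + e * (2 * b + 1)) by nra.
    assert (t0 : 0 < t) by (apply Rmin_glb_lt; [lra|now apply Rdiv_lt_0_compat]).
    destruct (Hc z Hz t t0) as (d & d0 & Hdd).
    exists (Rmin d t); split; [now apply Rmin_glb_lt|].
    intros w Hw; pose proof (Rmin_l d t); pose proof (Rmin_r d t).
    specialize (Hdd w ltac:(lra)).
    pose proof (Cmod_le_sub (k w) (k z)) as Ka; pose proof (Cmod_le_sub w z) as Kb.
    fold a in Ka; fold b in Kb; pose proof (Cmod_ge_0 (k w)); pose proof (Cmod_ge_0 w).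
    assert (t1 : t <= 1) by apply Rmin_l.
    assert (t2 : t * (2 * a + 1 + e * (2 * b + 1)) <= e').
    { pose proof (Rmin_r 1 (e' / (2 * a + 1 + e * (2 * b + 1)))) as T; fold t in T.
      apply (Rmult_le_compat_r (2 * a + 1 + e * (2 * b + 1))) in T; [|lra].
      unfold Rdiv in T; rewrite Rmult_assoc, Rinv_l in T; lra. }
    assert (Cmod (k w) ^ 2 < a ^ 2 + t * (2 * a + 1)) by nra.
    assert (Cmod w ^ 2 <= b ^ 2 + t * (2 * b + 1)) by nra.
    assert (e * Cmod w ^ 2 <= e * (b ^ 2 + t * (2 * b + 1)))
      by (apply Rmult_le_compat_l; lra).
    lra. }
  assert (HcR' : Cmod c = R).
  { destruct HcR as [HcR|]; auto; exfalso.
    (* The punctured disc of radius [rho] about c must avoid 0, where k may fail to be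
       differentiable: this is automatic for c = 0 and forced by rho <= |c| otherwise. *)
    set (rho := if Req_EM_T (Cmod c) 0 then R else Rmin (Cmod c) (R - Cmod c)).
    assert (Hrho : 0 < rho /\ rho <= R - Cmod c /\ (c = 0%C \/ rho <= Cmod c)).
    { unfold rho; pose proof (Cmod_ge_0 c).
      destruct (Req_EM_T (Cmod c) 0) as [E|E].
      - repeat split; try lra; left; now apply Cmod_eq_0.
      - repeat split; [apply Rmin_glb_lt; lra|apply Rmin_r|right; apply Rmin_l]. }
    destruct Hrho as (rho0 & rho1 & rho2).
    set (q := fun w => (Cconj (k c) * k w + RtoC e * Cconj c * (w + - c))%C).
    enough (Hq : fst (q c) <= Cmod (k c) ^ 2 - e * (rho / 2) ^ 2 / 2).
    { assert (Eq : fst (q c) = Cmod (k c) ^ 2).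
      { unfold q; rewrite Cmod2_alt; simpl; unfold Re, Im; ring. }
      assert (0 < e * (rho / 2) ^ 2) by (apply Rmult_lt_0_compat; auto; apply pow_lt; lra).
      lra. }
    apply (circle_Re_le q c (rho / 2) rho); [lra| | |].
    - intros w [Hw1 Hw2].
      destruct (Hd w) as [d Hdw].
      + intros ->; destruct rho2 as [-> |H].
        * replace (0 - 0)%C with (RtoC 0) in Hw1 by ring; rewrite Cmod_0 in Hw1; lra.
        * replace (0 - c)%C with (- c)%C in Hw2 by ring; rewrite Cmod_opp in Hw2; lra.
      + pose proof (Cmod_le_sub w c); lra.
      + eexists; apply C_deriv_at_plus; apply C_deriv_at_scal; [exact Hdw|].
        apply C_deriv_at_plus; [apply C_deriv_at_id|apply C_deriv_at_const].
    - apply C_continuous_at_plus; apply C_continuous_at_scal; [apply Hc; lra|].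
      eapply C_deriv_at_continuous.
      apply C_deriv_at_plus; [apply C_deriv_at_id|apply C_deriv_at_const].
    - intros w Hw.
      assert (HwR : Cmod w <= R) by (pose proof (Cmod_le_sub w c); lra).
      specialize (Hmax w HwR); cbv beta in Hmax.
      rewrite <- Hw; unfold q; rewrite !Cmod2_alt in *.
      destruct (k w) as [a b], (k c) as [a' b'], w as [x y], c as [x' y'].
      simpl in *; unfold Re, Im in *; simpl in *.
      (* Combines 2 Re (conj (k c) k w) <= |k c|^2 + |k w|^2 with 2 Re (conj c (w - c)) = |w|^2 -
         |c|^2 - |w - c|^2 and the maximality of c. *)
      pose proof (pow2_ge_0 (a - a')); pose proof (pow2_ge_0 (b - b')).
      nra. }
  specialize (Hmax w0 Hw0); cbv beta in Hmax; rewrite HcR' in Hmax.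
  specialize (Hb c HcR'); pose proof (Cmod_ge_0 (k c)).
  assert (0 <= e * Cmod w0 ^ 2) by (apply Rmult_le_pos; [lra|apply pow2_ge_0]).
  assert (Cmod (k c) ^ 2 <= M ^ 2) by nra.
  lra. }
apply Rnot_lt_le; intros Hlt.
assert (R2 : 0 < R ^ 2) by (apply pow_lt; auto).
assert (Hpos : 0 < Cmod (k w0) ^ 2 - M ^ 2) by nra.
specialize (He ((Cmod (k w0) ^ 2 - M ^ 2) / (2 * R ^ 2))
  ltac:(apply Rdiv_lt_0_compat; lra)).
replace ((Cmod (k w0) ^ 2 - M ^ 2) / (2 * R ^ 2) * R ^ 2)
  with ((Cmod (k w0) ^ 2 - M ^ 2) / 2) in He by (field; lra).
lra.
Qed.

(** Maximum principle for the difference quotient of h at 0, completed there by the derivative. It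
    is bounded by 2M/R on the boundary circle; at 0 the derivative of h gives continuity of the
    quotient, which is enough for [max_modulus_disc]. *)
Lemma schwarz_lipschitz (h : C -> C) (R M : R) :
  0 < R ->
  (forall w, Cmod w <= R -> exists d, C_deriv_at h w d) ->
  (forall w, Cmod w <= R -> Cmod (h w) <= M) ->
  forall w, Cmod w <= R -> Cmod (h w - h 0)%C <= 2 * M / R * Cmod w.
Proof.
intros HR Hd HM.
destruct (Hd 0%C) as [d0 Hd0]; [rewrite Cmod_0; lra|].
assert (M0 : 0 <= M) by (eapply Rle_trans; [apply Cmod_ge_0|apply (HM 0%C)];
  rewrite Cmod_0; lra).
set (k := fun w => if Ceq_dec w 0 then d0 else ((h w - h 0) / w)%C).
assert (k_ne : forall w : C, w <> 0%C -> k w = ((h w - h 0) / w)%C).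
{ intros w Hw; unfold k; destruct (Ceq_dec w 0); [contradiction|reflexivity]. }
assert (k_d : forall w : C, w <> 0%C -> Cmod w <= R -> exists d, C_deriv_at k w d).
{ intros w Hw HwR; destruct (Hd w HwR) as [d Hdw].
  eexists; apply (C_deriv_at_ext_loc (fun w => (h w + - h 0) * / w)%C k _ _ (Cmod w)).
  - now apply Cmod_gt_0.
  - intros u Hu; symmetry; apply k_ne; intros ->.
    replace (0 - w)%C with (- w)%C in Hu by ring; rewrite Cmod_opp in Hu; lra.
  - apply C_deriv_at_mult; [|now apply C_deriv_at_inv].
    apply C_deriv_at_plus; [exact Hdw|apply C_deriv_at_const]. }
assert (Hk : forall w, Cmod w <= R -> Cmod (k w) <= 2 * M / R).
{ apply max_modulus_disc; auto.
  - unfold Rdiv; apply Rmult_le_pos; [lra|left; now apply Rinv_0_lt_compat].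
  - intros w HwR; destruct (Ceq_dec w 0) as [->|Hw].
    + intros e e0; destruct (Hd0 (e / 2)) as (r & r0 & Hr); [lra|].
      exists r; split; auto; intros w Hw.
      unfold k at 2; destruct (Ceq_dec 0 0) as [_|[]]; [|reflexivity].
      destruct (Ceq_dec w 0) as [->|Hw0].
      * unfold k; destruct (Ceq_dec 0 0) as [_|[]]; [|reflexivity].
        replace (d0 - d0)%C with (RtoC 0) by ring; now rewrite Cmod_0.
      * rewrite k_ne by auto; specialize (Hr w Hw).
        replace (w - 0)%C with w in Hr by ring.
        replace ((h w - h 0) / w - d0)%C with ((h w - h 0 - d0 * w) * / w)%C
          by (field; auto).
        assert (P : 0 < Cmod w) by now apply Cmod_gt_0.
        rewrite Cmod_mult, Cmod_inv by auto.
        apply (Rmult_le_compat_r (/ Cmod w)) in Hr;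
          [|left; now apply Rinv_0_lt_compat].
        rewrite Rmult_assoc, Rinv_r in Hr by lra; lra.
    + destruct (k_d w Hw HwR) as [d Hdw]; exact (C_deriv_at_continuous _ _ _ Hdw).
  - intros w Hw HwR; apply k_d; auto; lra.
  - intros w HwR.
    assert (w <> 0%C) by (apply Cmod_gt_0; lra).
    rewrite k_ne, Cmod_div, HwR by auto.
    apply Rmult_le_compat_r; [left; now apply Rinv_0_lt_compat|].
    pose proof (Cmod_triangle (h w) (- h 0)) as T; rewrite Cmod_opp in T.
    pose proof (HM w ltac:(lra)); pose proof (HM 0%C ltac:(rewrite Cmod_0; lra)).
    unfold Cminus; lra. }
intros w HwR; destruct (Ceq_dec w 0) as [->|Hw].
- replace (h 0 - h 0)%C with (RtoC 0) by ring; rewrite Cmod_0; lra.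
- specialize (Hk w HwR); rewrite k_ne, Cmod_div in Hk by auto.
  assert (P : 0 < Cmod w) by now apply Cmod_gt_0.
  apply (Rmult_le_compat_r (Cmod w)) in Hk; [|lra].
  unfold Rdiv in Hk at 1; rewrite Rmult_assoc, Rinv_l in Hk by lra; lra.
Qed.

(** * The weighted disc *)

(** A C-linear map on C is multiplication by its value at 1. *)
Lemma holomorphic_on_C_deriv_at (U : C -> Prop) (h : C -> C) (z : C) :
  holomorphic_on (E := C_NormedModule) (F := C_NormedModule) U h -> U z ->
  exists d, C_deriv_at h z d.
Proof.
intros Hh Uz; destruct (Hh z Uz) as (l & Hl & Hdom).
exists (l (RtoC 1)); intros e e0.
destruct (Hdom z (fun P HP => HP) (mkposreal e e0)) as [r Hr].
exists r; split; [apply r|]; intros w Hw.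
specialize (Hr w (norm_compat1 (V := C_NormedModule) _ _ _ Hw)).
assert (El : l (w - z)%C = (l (RtoC 1) * (w - z))%C).
{ replace (w - z)%C with (scal (w - z)%C (RtoC 1) : C_NormedModule) at 1
    by (change ((w - z) * 1 = w - z)%C; ring).
  rewrite (linear_scal l Hl); apply Cmult_comm. }
rewrite <- El; exact Hr.
Qed.

Lemma C_deriv_at_scal_vector {F : NormedModule C_AbsRing} (g : C -> C) (z d : C) (x : F) :
  C_deriv_at g z d ->
  ex_filterdiff (fun w : C_NormedModule => scal (g w : C_AbsRing) x) (locally z).
Proof.
intros Hg; exists (fun w : C_NormedModule => scal (d * w : C_AbsRing)%C x); split.
- split.
  + intros u w; rewrite <- (scal_distr_r (V := F)); f_equal; apply Cmult_plus_distr_l.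
  + intros k u; rewrite (scal_assoc (V := F)); f_equal.
    change (d * (k * u) = k * (d * u))%C; ring.
  (* Linearity asks for a strictly positive bound, hence the + 1. *)
  + exists (Cmod d * norm x + 1); split.
    * pose proof (Rmult_le_pos _ _ (Cmod_ge_0 d) (norm_ge_0 x)); lra.
    * intros u; eapply Rle_trans; [apply norm_scal|].
      change (Cmod (d * u) * norm x <= (Cmod d * norm x + 1) * Cmod u).
      rewrite Cmod_mult; pose proof (Cmod_ge_0 u); nra.
- intros z' Hz'; rewrite <- (is_filter_lim_locally_unique (K := C_AbsRing) z z' Hz').
  intros e; pose proof (norm_ge_0 x) as x0.
  destruct (Hg (e / (norm x + 1))) as (r & r0 & Hr);
    [apply Rdiv_lt_0_compat; [apply e|lra]|].
  apply (locally_le_locally_norm (V := C_NormedModule)).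
  exists (mkposreal r r0); intros w Hw; specialize (Hr w Hw).
  assert (E : minus (minus (scal (g w : C_AbsRing) x) (scal (g z : C_AbsRing) x))
    (scal (d * minus w z : C_AbsRing)%C x) =
    scal (g w - g z - d * (w - z) : C_AbsRing)%C x).
  { unfold minus; rewrite <- !(scal_opp_l (V := F)), <- !(scal_distr_r (V := F)); reflexivity. }
  eapply Rle_trans; [apply Req_le, (f_equal norm), E|].
  eapply Rle_trans; [apply norm_scal|].
  change (Cmod (g w - g z - d * (w - z))%C * norm x <= e * Cmod (w - z)%C).
  pose proof (Cmod_ge_0 (w - z)%C).
  apply Rle_trans with (e / (norm x + 1) * Cmod (w - z)%C * (norm x + 1)).
  + apply Rmult_le_compat; auto; [apply Cmod_ge_0|lra].
  + apply Req_le; field; lra.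
Qed.

(** The normed-module axioms give only one inequality; the other follows by scaling back by the
    inverse of a. *)
Lemma norm_scal_C {F : NormedModule C_AbsRing} (a : C) (x : F) :
  norm (scal (a : C_AbsRing) x) = Cmod a * norm x.
Proof.
apply Rle_antisym; [exact (norm_scal (K := C_AbsRing) (V := F) a x)|].
destruct (Ceq_dec a 0) as [->|Ha].
- rewrite Cmod_0, Rmult_0_l; apply norm_ge_0.
- assert (P : 0 < Cmod a) by now apply Cmod_gt_0.
  replace x with (scal (/ a : C_AbsRing)%C (scal (a : C_AbsRing) x)) at 1.
  2: { rewrite (scal_assoc (V := F)); change (scal (/ a * a : C_AbsRing)%C x = x).
       rewrite Cinv_l by auto; apply (scal_one (V := F)). }
  eapply Rle_trans; [apply Rmult_le_compat_l; [lra|apply norm_scal]|].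
  change (Cmod a * (Cmod (/ a) * norm (scal (a : C_AbsRing) x)) <= norm (scal (a : C_AbsRing) x)).
  rewrite Cmod_inv, <- Rmult_assoc, Rinv_r by (auto; lra); lra.
Qed.

Lemma wnorm_le {E F : NormedModule C_AbsRing} (U : E -> Prop) (v : E -> R)
    (f : E -> F) (M : R) :
  Rbar_le (wnorm U v f) M <-> forall z, U z -> v z * norm (f z) <= M.
Proof.
destruct (Lub_Rbar_correct (fun r => exists z, U z /\ r = v z * norm (f z)))
  as [Hub Hlub].
split.
- intros H z Uz.
  apply (Rbar_le_trans (v z * norm (f z)) (wnorm U v f) M); auto.
  apply Hub; now exists z.
- intros H; apply Hlub; intros y (z & Uz & ->); now apply H.
Qed.

Lemma wnorm_eq_max {E F : NormedModule C_AbsRing} (U : E -> Prop) (v : E -> R)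
    (f : E -> F) (M : R) (z0 : E) :
  (forall z, U z -> v z * norm (f z) <= M) -> U z0 -> v z0 * norm (f z0) = M ->
  wnorm U v f = M.
Proof.
intros H Uz0 Hz0; apply is_lub_Rbar_unique; split.
- intros y (z & Uz & ->); now apply H.
- intros b Hb; apply Hb; now exists z0.
Qed.

(** * Automorphisms of the disc and peak functions *)

Definition disc_involution (z w : C) : C := ((z - w) / (1 - Cconj z * w))%C.

(** Keeps 1 - conj z * w in the half-plane where [Clog] is differentiable, which permits real
    exponents p, and away from 0 uniformly in w. *)
Lemma Re_one_minus_conj_mult (z w : C) :
  Cmod z < 1 -> Cmod w < 1 -> 1 - Cmod z <= fst (1 - Cconj z * w)%C.
Proof.
intros Hz Hw; pose proof (re_le_Cmod (Cconj z * w)%C) as H.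
rewrite Cmod_mult, Cmod_conj in H; apply Rabs_le_between in H.
pose proof (Cmod_ge_0 z); pose proof (Cmod_ge_0 w).
assert (fst (1 - Cconj z * w)%C = 1 - Re (Cconj z * w)%C) by reflexivity; nra.
Qed.

Lemma one_minus_conj_mult_neq_0 (z w : C) :
  Cmod z < 1 -> Cmod w < 1 -> (1 - Cconj z * w)%C <> 0%C.
Proof.
intros Hz Hw H; pose proof (Re_one_minus_conj_mult z w Hz Hw) as K.
rewrite H in K; simpl in K; lra.
Qed.

Lemma Cmod_disc_involution (z w : C) : Cmod z < 1 -> Cmod w < 1 ->
  1 - Cmod (disc_involution z w) ^ 2 =
  (1 - Cmod z ^ 2) * (1 - Cmod w ^ 2) / Cmod (1 - Cconj z * w)%C ^ 2.
Proof.
intros Hz Hw; pose proof (one_minus_conj_mult_neq_0 z w Hz Hw) as Hd.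
assert (P : 0 < Cmod (1 - Cconj z * w)%C) by now apply Cmod_gt_0.
unfold disc_involution; rewrite Cmod_div by auto.
assert (E : Cmod (1 - Cconj z * w)%C ^ 2 - Cmod (z - w)%C ^ 2 =
  (1 - Cmod z ^ 2) * (1 - Cmod w ^ 2)).
{ rewrite !Cmod2_alt; destruct z, w; unfold Re, Im; simpl; ring. }
rewrite <- E; field; lra.
Qed.

Lemma one_minus_sqr_pos (t : R) : 0 <= t < 1 -> 0 < 1 - t ^ 2.
Proof. intros; nra. Qed.

Lemma disc_involution_in_disc (z w : C) :
  Cmod z < 1 -> Cmod w < 1 -> Cmod (disc_involution z w) < 1.
Proof.
intros Hz Hw; pose proof (Cmod_disc_involution z w Hz Hw) as E.
assert (P : 0 < Cmod (1 - Cconj z * w)%C)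
  by (apply Cmod_gt_0; now apply one_minus_conj_mult_neq_0).
assert (0 < (1 - Cmod z ^ 2) * (1 - Cmod w ^ 2) / Cmod (1 - Cconj z * w)%C ^ 2).
{ apply Rdiv_lt_0_compat; [|now apply pow_lt].
  apply Rmult_lt_0_compat; apply one_minus_sqr_pos; split; auto; apply Cmod_ge_0. }
pose proof (Cmod_ge_0 (disc_involution z w)); nra.
Qed.

Lemma disc_involution_involutive (z w : C) : Cmod z < 1 -> Cmod w < 1 ->
  disc_involution z (disc_involution z w) = w.
Proof.
intros Hz Hw; pose proof (one_minus_conj_mult_neq_0 z w Hz Hw) as Hd.
pose proof (one_minus_conj_mult_neq_0 z z Hz Hz) as Hzz.
unfold disc_involution.
replace (z - (z - w) / (1 - Cconj z * w))%C
  with (w * (1 - Cconj z * z) / (1 - Cconj z * w))%C by (field; auto).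
replace (1 - Cconj z * ((z - w) / (1 - Cconj z * w)))%C
  with ((1 - Cconj z * z) / (1 - Cconj z * w))%C by (field; auto).
field; auto.
Qed.

Lemma disc_involution_0 (z : C) : disc_involution z 0 = z.
Proof.
unfold disc_involution; replace (1 - Cconj z * 0)%C with (RtoC 1) by ring.
field; apply C1_nz.
Qed.

Lemma disc_involution_diag (z : C) : Cmod z < 1 -> disc_involution z z = 0%C.
Proof.
intros Hz; unfold disc_involution; replace (z - z)%C with (RtoC 0) by ring.
field; now apply one_minus_conj_mult_neq_0.
Qed.

Lemma C_deriv_at_one_minus_mult (a w : C) :
  C_deriv_at (fun w => 1 - a * w)%C w (- a)%C.
Proof.
replace (- a)%C with (0 + - a * 1)%C by ring.
apply (C_deriv_at_ext_loc (fun w => 1 + - a * w)%C _ _ _ 1); [lra|intros; ring|].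
apply C_deriv_at_plus; [apply C_deriv_at_const|apply C_deriv_at_scal, C_deriv_at_id].
Qed.

Lemma C_deriv_at_disc_involution (z w : C) :
  Cmod z < 1 -> Cmod w < 1 -> exists d, C_deriv_at (disc_involution z) w d.
Proof.
intros Hz Hw; eexists.
apply (C_deriv_at_mult (fun w => z - w)%C (fun w => / (1 - Cconj z * w))%C).
- apply (C_deriv_at_ext_loc (fun w => z + - (1) * w)%C _ _ _ 1); [lra|intros; ring|].
  apply C_deriv_at_plus; [apply C_deriv_at_const|apply C_deriv_at_scal, C_deriv_at_id].
- apply (C_deriv_at_comp (fun w => 1 - Cconj z * w)%C Cinv).
  + apply C_deriv_at_one_minus_mult.
  + now apply C_deriv_at_inv, one_minus_conj_mult_neq_0.
Qed.

(* A power of the derivative of [disc_involution z]: it turns composition with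
   the involution into an isometry of the weighted space, and its weighted
   modulus peaks exactly at z. *)
Definition disc_peak (p : R) (z w : C) : C :=
  (disc_weight p z * Cpower (1 - Cconj z * w) (-2 * p))%C.

Lemma disc_weight_pos (p : R) (z : C) : 0 < disc_weight p z.
Proof. apply exp_pos. Qed.

Lemma weight_mult_Cmod_disc_peak (p : R) (z w : C) : Cmod z < 1 -> Cmod w < 1 ->
  disc_weight p w * Cmod (disc_peak p z w) = disc_weight p (disc_involution z w).
Proof.
intros Hz Hw.
assert (P : 0 < Cmod (1 - Cconj z * w)%C)
  by (apply Cmod_gt_0; now apply one_minus_conj_mult_neq_0).
assert (Pz : 0 < 1 - Cmod z ^ 2) by (apply one_minus_sqr_pos; split; auto; apply Cmod_ge_0).
assert (Pw : 0 < 1 - Cmod w ^ 2) by (apply one_minus_sqr_pos; split; auto; apply Cmod_ge_0).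
assert (P2 : 0 < Cmod (1 - Cconj z * w)%C ^ 2) by now apply pow_lt.
unfold disc_peak; rewrite Cmod_mult, Cmod_R, Rabs_pos_eq by (left; apply disc_weight_pos).
rewrite Cmod_Cpower; unfold disc_weight; rewrite Cmod_disc_involution by auto.
(* What remains is the logarithm of [Cmod_disc_involution], multiplied by p. *)
unfold Rpower; rewrite <- !exp_plus; f_equal.
unfold Rdiv; rewrite !ln_mult, ln_Rinv; auto; [field| |];
  try apply Rmult_lt_0_compat; auto; now apply Rinv_0_lt_compat.
Qed.

Lemma disc_peak_0 (p : R) (z : C) : disc_peak p z 0 = disc_weight p z.
Proof.
unfold disc_peak; replace (1 - Cconj z * 0)%C with (RtoC 1) by ring.
rewrite Cpower_pos_real, Cmod_Cpower, Cmod_1 by lra.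
unfold Rpower; rewrite pow1, ln_1, Rmult_0_r, exp_0; ring.
Qed.

(** At w = z the base of the power is the positive real 1 - |z|^2, so the peak carries no phase
    there and a bump along f(z) stays a positive multiple of f(z). *)
Lemma disc_peak_diag (p : R) (z : C) :
  Cmod z < 1 -> disc_peak p z z = Cmod (disc_peak p z z).
Proof.
intros Hz; unfold disc_peak.
assert (E : (1 - Cconj z * z)%C = RtoC (1 - Cmod z ^ 2)).
{ rewrite RtoC_minus, Cmod2_conj; ring. }
rewrite Cmod_mult, Cmod_R, Rabs_pos_eq, E, RtoC_mult by (left; apply disc_weight_pos).
f_equal; apply Cpower_pos_real, one_minus_sqr_pos; split; auto; apply Cmod_ge_0.
Qed.

Lemma C_deriv_at_disc_peak (p : R) (z w : C) :
  Cmod z < 1 -> Cmod w < 1 -> exists d, C_deriv_at (disc_peak p z) w d.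
Proof.
intros Hz Hw; pose proof (Re_one_minus_conj_mult z w Hz Hw) as HR.
destruct (C_deriv_at_Cpower (1 - Cconj z * w)%C (-2 * p)) as [d Hd]; [lra|].
eexists; apply C_deriv_at_scal.
apply (C_deriv_at_comp (fun w => 1 - Cconj z * w)%C (fun u => Cpower u (-2 * p)));
  [apply C_deriv_at_one_minus_mult|exact Hd].
Qed.

Lemma disc_weight_antitone (p r : R) (z : C) : 0 <= p -> Cmod z < 1 -> 0 <= r <= Cmod z ->
  disc_weight p z <= Rpower (1 - r ^ 2) p.
Proof.
intros Hp Hz Hr; apply Rle_Rpower_l; auto; split; [|nra].
apply one_minus_sqr_pos; lra.
Qed.

Lemma disc_weight_ge (p r : R) (z : C) : 0 <= p -> r < 1 -> Cmod z <= r ->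
  Rpower (1 - r ^ 2) p <= disc_weight p z.
Proof.
intros Hp Hr Hz; pose proof (Cmod_ge_0 z).
apply Rle_Rpower_l; auto; split; [apply one_minus_sqr_pos; lra|nra].
Qed.

Lemma disc_weight_le_1 (p : R) (z : C) : 0 <= p -> Cmod z < 1 -> disc_weight p z <= 1.
Proof.
intros Hp Hz; eapply Rle_trans.
{ apply (disc_weight_antitone p 0); auto; split; [lra|apply Cmod_ge_0]. }
unfold Rpower; replace (1 - 0 ^ 2) with 1 by ring; rewrite ln_1, Rmult_0_r, exp_0; lra.
Qed.

(** The radius does not depend on z because the involution moves every comparison to a neighbourhood
    of 0, where one bound M serves all z and all h in the ball. *)
Lemma disc_evaluations_close (p : R) (eps : R) : 0 <= p -> 0 < eps ->
  exists r, 0 < r < 1 /\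
  forall z z0 lambda : C, Cmod z < 1 -> Cmod z0 < 1 -> Cmod lambda = 1 ->
    Cmod (disc_involution z z0) <= r ->
    exists lambda0, Cmod lambda0 = 1 /\
    forall h : C -> C, Hinf_ball (F := C_NormedModule) unit_disc (disc_weight p) h ->
      Cmod (lambda * disc_weight p z * h z
            - lambda0 * disc_weight p z0 * h z0)%C <= eps.
Proof.
intros Hp Heps.
set (M := / Rpower (1 - (1 / 2) ^ 2) p).
assert (M0 : 0 < M) by (apply Rinv_0_lt_compat, exp_pos).
assert (Hcont : exists r, 0 < r /\ forall t, 0 <= t <= r ->
  1 - Rpower (1 - t ^ 2) p <= eps / (2 * M)).
{ assert (Hc : continuous (fun t => exp (p * ln (1 - t ^ 2))) 0).
  { apply (@ex_derive_continuous R_AbsRing R_NormedModule); auto_derive; lra. }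
  assert (He : 0 < eps / (2 * M)) by (apply Rdiv_lt_0_compat; lra).
  destruct (proj1 (filterlim_locally _ _) Hc (mkposreal _ He)) as [d Hd].
  exists (d / 2); pose proof (cond_pos d); split; [lra|]; intros t Ht.
  specialize (Hd t).
  assert (B : Rabs (t - 0) < d) by (rewrite Rabs_pos_eq; lra).
  specialize (Hd B).
  assert (Hd' : Rabs (exp (p * ln (1 - t ^ 2)) - exp (p * ln (1 - 0 ^ 2))) < eps / (2 * M))
    by exact Hd.
  replace (1 - 0 ^ 2) with 1 in Hd' by ring; rewrite ln_1, Rmult_0_r, exp_0 in Hd'.
  apply Rabs_lt_between in Hd'; unfold Rpower; lra. }
destruct Hcont as (r1 & r10 & Hr1).
(* Schwarz on the disc of radius 1/2 costs 4M|b|, at most eps/2 when |b| <= eps/(8M); [r1] makes (1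
   - v(b)) |K b| at most eps/2. *)
set (r := Rmin (1 / 2) (Rmin r1 (eps / (8 * M)))).
assert (r0 : 0 < r) by
  (repeat apply Rmin_glb_lt; auto; [lra|apply Rdiv_lt_0_compat; lra]).
assert (rle : r <= 1 / 2 /\ r <= r1 /\ r <= eps / (8 * M)).
{ pose proof (Rmin_l (1 / 2) (Rmin r1 (eps / (8 * M)))).
  pose proof (Rmin_r (1 / 2) (Rmin r1 (eps / (8 * M)))).
  pose proof (Rmin_l r1 (eps / (8 * M))); pose proof (Rmin_r r1 (eps / (8 * M))).
  unfold r; lra. }
exists r; split; [lra|].
intros z z0 lambda Hz Hz0 Hlambda Hb.
set (b := disc_involution z z0) in *.
assert (Hb1 : Cmod b < 1) by lra.
assert (Ez0 : disc_involution z b = z0) by now apply disc_involution_involutive.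
set (G := disc_peak p z b).
pose proof (weight_mult_Cmod_disc_peak p z b Hz Hb1) as EG; fold G in EG; rewrite Ez0 in EG.
assert (vb := disc_weight_pos p b); assert (vz0 := disc_weight_pos p z0).
assert (G0 : 0 < Cmod G) by nra.
assert (G0' : G <> 0%C) by now apply Cmod_gt_0.
assert (G0'' : RtoC (Cmod G) <> 0%C) by (intros H; apply RtoC_inj in H; lra).
(* As K b = h(z0) G and v(b) |G| = v(z0), this phase turns v(z0) h(z0) into v(b) K b; it involves
   only lambda, z and z0. *)
exists (lambda * (G / Cmod G))%C; split.
{ rewrite Cmod_mult, Cmod_div, Cmod_R, Rabs_pos_eq, Hlambda by (auto; lra); field; lra. }
intros h [[Hhol _] Hh].
assert (Hbound : forall w, Cmod w < 1 -> disc_weight p w * Cmod (h w) <= 1)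
  by exact (proj1 (wnorm_le _ _ _ _) Hh).
set (K := fun w => (h (disc_involution z w) * disc_peak p z w)%C).
assert (HK : forall w, Cmod w <= 1 / 2 -> Cmod (K w) <= M).
{ intros w Hw; assert (Hw1 : Cmod w < 1) by lra.
  pose proof (Hbound _ (disc_involution_in_disc z w Hz Hw1)) as B.
  rewrite <- weight_mult_Cmod_disc_peak in B by auto.
  unfold K; rewrite Cmod_mult.
  pose proof (disc_weight_ge p (1 / 2) w Hp ltac:(lra) Hw) as W.
  pose proof (exp_pos (p * ln (1 - (1 / 2) ^ 2))) as W0; fold (Rpower (1 - (1/2)^2) p) in W0.
  apply (Rmult_le_reg_l (Rpower (1 - (1 / 2) ^ 2) p)); auto.
  unfold M; rewrite Rinv_r by lra.
  assert (0 <= Cmod (h (disc_involution z w)) * Cmod (disc_peak p z w))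
    by (apply Rmult_le_pos; apply Cmod_ge_0).
  nra. }
assert (HKd : forall w, Cmod w <= 1 / 2 -> exists d, C_deriv_at K w d).
{ intros w Hw; assert (Hw1 : Cmod w < 1) by lra.
  destruct (C_deriv_at_disc_involution z w Hz Hw1) as [d1 H1].
  destruct (C_deriv_at_disc_peak p z w Hz Hw1) as [d2 H2].
  destruct (holomorphic_on_C_deriv_at unit_disc h (disc_involution z w) Hhol
    (disc_involution_in_disc z w Hz Hw1)) as [d3 H3].
  eexists; apply C_deriv_at_mult; [|exact H2].
  exact (C_deriv_at_comp _ _ _ _ _ H1 H3). }
pose proof (schwarz_lipschitz K (1 / 2) M ltac:(lra) HKd HK b ltac:(lra)) as HL.
(* The difference is lambda (K 0 - v(b) K b), split into a variation of K and a defect of the weight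
   at b. *)
replace (lambda * disc_weight p z * h z -
  lambda * (G / Cmod G) * disc_weight p z0 * h z0)%C
  with (lambda * (- (K b - K 0) + RtoC (1 - disc_weight p b) * K b))%C.
2: { unfold K; rewrite disc_involution_0, disc_peak_0, Ez0; fold G.
     rewrite <- EG, RtoC_mult, RtoC_minus; field; auto. }
rewrite Cmod_mult, Hlambda, Rmult_1_l.
eapply Rle_trans; [apply Cmod_triangle|].
rewrite Cmod_opp, Cmod_mult, Cmod_R, Rabs_pos_eq
  by (pose proof (disc_weight_le_1 p b Hp Hb1); lra).
assert (V : 1 - disc_weight p b <= eps / (2 * M)).
{ apply Hr1; split; [apply Cmod_ge_0|lra]. }
specialize (HK b ltac:(lra)).
assert (T1 : (1 - disc_weight p b) * Cmod (K b) <= eps / (2 * M) * M).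
{ apply Rmult_le_compat; auto; [|apply Cmod_ge_0].
  pose proof (disc_weight_le_1 p b Hp Hb1); lra. }
assert (T2 : 2 * M / (1 / 2) * Cmod b <= 2 * M / (1 / 2) * (eps / (8 * M))).
{ apply Rmult_le_compat_l; [|lra].
  apply Rmult_le_pos; [lra|left; apply Rinv_0_lt_compat; lra]. }
replace (eps / (2 * M) * M) with (eps / 2) in T1 by (field; lra).
replace (2 * M / (1 / 2) * (eps / (8 * M))) with (eps / 2) in T2 by (field; lra).
lra.
Qed.

(** * Attainment of the weighted norm *)

Lemma weighted_norm_continuous {F : NormedModule C_AbsRing} (p : R) (f : C -> F) (z : C) :
  Cmod z < 1 -> ex_filterdiff (f : C_NormedModule -> F) (locally z) ->
  forall e, 0 < e -> exists d, 0 < d /\ forall w, Cmod (w - z)%C < d ->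
    Cmod w < 1 /\
    Rabs (disc_weight p w * norm (f w) - disc_weight p z * norm (f z)) < e.
Proof.
intros Hz Hf e e0.
assert (H : filterlim (fun w : C_NormedModule => disc_weight p w * norm (f w))
  (within unit_disc (locally z)) (locally (disc_weight p z * norm (f z)))).
{ apply (filterlim_comp_2 (G := locally (disc_weight p z)) (H := locally (norm (f z)))
    (disc_weight p) (fun w => norm (f w)) Rmult).
  - exact (proj2 (disc_weight_is_weight p z Hz)).
  - apply (filterlim_filter_le_1 (G := within unit_disc (locally z)) (F := locally z)).
    { intros P [d Hd]; exists d; intros y yd _; exact (Hd y yd). }
    apply (filterlim_comp _ _ _ f norm (locally z) (locally (f z))).
    + exact (filterdiff_continuous _ _ Hf).
    + apply filterlim_norm.
  - exact (filterlim_mult (K := R_AbsRing) (disc_weight p z) (norm (f z))). }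
destruct (proj1 (filterlim_locally _ _) H (mkposreal e e0)) as [d Hd].
exists (Rmin d (1 - Cmod z)); split; [apply Rmin_glb_lt; [apply d|lra]|].
intros w Hw; pose proof (Rmin_l d (1 - Cmod z)); pose proof (Rmin_r d (1 - Cmod z)).
assert (Hw1 : Cmod w < 1) by (pose proof (Cmod_le_sub w z); lra).
split; auto; apply Hd; [|exact Hw1].
apply (norm_compat1 (V := C_NormedModule)); change (Cmod (w - z)%C < d); lra.
Qed.

(** Supplies a compact Euclidean disc on which a maximum can be taken. *)
Lemma pseudohyperbolic_disc_bounded (z : C) (r : R) : Cmod z < 1 -> 0 <= r < 1 ->
  exists R0, 0 <= R0 < 1 /\
  forall w, Cmod w < 1 -> Cmod (disc_involution z w) <= r -> Cmod w <= R0.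
Proof.
intros Hz Hr; pose proof (Cmod_ge_0 z) as z0.
(* Lower bound for 1 - |w|^2, from [Cmod_disc_involution] and |1 - conj z w| >= 1 - |z|. The radius
   1 - kappa/2 is at least the square root of 1 - kappa. *)
set (kappa := (1 - r ^ 2) * (1 - Cmod z) ^ 2 / (1 - Cmod z ^ 2)).
assert (Pr : 0 < 1 - r ^ 2) by (apply one_minus_sqr_pos; auto).
assert (Pz : 0 < 1 - Cmod z ^ 2) by (apply one_minus_sqr_pos; lra).
assert (k0 : 0 < kappa) by
  (apply Rdiv_lt_0_compat; auto; apply Rmult_lt_0_compat; auto; apply pow_lt; lra).
assert (k1 : kappa <= 1).
{ apply (Rmult_le_reg_r (1 - Cmod z ^ 2)); auto.
  unfold kappa, Rdiv; rewrite Rmult_assoc, Rinv_l by lra.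
  assert ((1 - r ^ 2) * (1 - Cmod z) ^ 2 <= 1 * (1 - Cmod z ^ 2))
    by (apply Rmult_le_compat; nra).
  lra. }
exists (1 - kappa / 2); split; [lra|]; intros w Hw Hd.
pose proof (Cmod_disc_involution z w Hz Hw) as E.
pose proof (Re_one_minus_conj_mult z w Hz Hw) as HR.
pose proof (re_le_Cmod (1 - Cconj z * w)%C) as HC; unfold Re in HC.
apply Rabs_le_between in HC.
set (D := Cmod (1 - Cconj z * w)%C) in *.
assert (D0 : 1 - Cmod z <= D) by lra.
pose proof (Cmod_ge_0 (disc_involution z w)); pose proof (Cmod_ge_0 w).
assert (E' : (1 - Cmod (disc_involution z w) ^ 2) * D ^ 2 =
  (1 - Cmod z ^ 2) * (1 - Cmod w ^ 2)) by (rewrite E; field; lra).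
assert (Hk : kappa * (1 - Cmod z ^ 2) = (1 - r ^ 2) * (1 - Cmod z) ^ 2)
  by (unfold kappa; field; lra).
assert ((1 - r ^ 2) * (1 - Cmod z) ^ 2 <= (1 - Cmod (disc_involution z w) ^ 2) * D ^ 2).
{ apply Rmult_le_compat; try nra. }
assert (kappa <= 1 - Cmod w ^ 2) by (apply (Rmult_le_reg_r (1 - Cmod z ^ 2)); lra).
nra.
Qed.

Lemma norm_minus_triangle {K : AbsRing} {V : NormedModule K} (x y : V) :
  norm (minus x y) <= norm x + norm y.
Proof. rewrite <- (norm_opp y); apply norm_triangle. Qed.

Lemma minus_shift {G : AbelianGroup} (a b s : G) :
  minus a b = minus (minus (plus a s) b) s.
Proof.
unfold minus.
now rewrite <- !plus_assoc, (plus_comm (opp b)), (plus_assoc s), plus_opp_r, plus_zero_l.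
Qed.

Lemma scal_one_minus {K : Ring} {V : ModuleSpace K} (a : K) (x : V) :
  scal (minus one a) x = minus x (scal a x).
Proof. now rewrite scal_minus_distr_r, scal_one. Qed.

Theorem theorem1p6 (p : R) (hp : 1 <= p) (F : CompleteNormedModule C_AbsRing) :
  WHinf_BPB unit_disc (disc_weight p) F.
Proof.
intros eps [eps0 eps1]; assert (p0 : 0 < p) by lra.
destruct (disc_evaluations_close p (eps / 2)) as (r & [r0 r1] & Hclose); try lra.
set (c := eps / 8); set (vr := Rpower (1 - r ^ 2) p).
assert (c0 : 0 < c) by (unfold c; lra).
assert (vr0 : 0 < vr) by apply exp_pos.
assert (vr1 : vr < 1).
{ unfold vr; replace 1 with (Rpower 1 p) at 2
    by (unfold Rpower; rewrite ln_1, Rmult_0_r; apply exp_0).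
  apply Rlt_Rpower_l; auto; split; [|nra]; apply one_minus_sqr_pos; lra. }
(* The sum exceeds 1 - eta + c at z and is at most 1 + c vr outside the pseudohyperbolic disc; any
   eta below c (1 - vr) separates the two. Then also eta < c, which gives N >= 1. *)
exists (c * (1 - vr) / 2); split; [unfold c in *; nra|].
intros f lambda z [[Hhol _] Hf] Hlambda Hz Hfz; unfold unit_disc in Hz.
assert (Hv1 : forall w, Cmod w < 1 -> disc_weight p w * norm (f w) <= 1).
{ apply (wnorm_le unit_disc); rewrite Hf; apply Rbar_le_refl. }
assert (vz : 0 < disc_weight p z) by apply disc_weight_pos.
assert (nz : 0 < norm (f z)) by (assert (c <= 1) by (unfold c; lra); nra).
set (x := scal (RtoC (c / norm (f z)) : C_AbsRing) (f z)).
assert (Hx : norm x = c).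
{ unfold x; rewrite norm_scal_C, Cmod_R, Rabs_pos_eq; [field; lra|].
  left; now apply Rdiv_lt_0_compat. }
set (f1 := fun w => plus (f w) (scal (disc_peak p z w : C_AbsRing) x)).
assert (Hpeak : forall w, Cmod w < 1 ->
  disc_weight p w * norm (scal (disc_peak p z w : C_AbsRing) x) =
  c * disc_weight p (disc_involution z w)).
{ intros w Hw; rewrite norm_scal_C, Hx, <- weight_mult_Cmod_disc_peak by auto; ring. }
assert (Hf1d : forall w, Cmod w < 1 -> ex_filterdiff (f1 : C_NormedModule -> F) (locally w)).
{ intros w Hw; destruct (C_deriv_at_disc_peak p z w Hz Hw) as [d Hd].
  destruct (C_deriv_at_scal_vector _ _ _ x Hd) as [l2 H2].
  destruct (Hhol w Hw) as [l1 H1].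
  eexists; exact (filterdiff_plus_fct f _ l1 l2 H1 H2). }
assert (Hf1 : forall w, Cmod w < 1 -> disc_weight p w * norm (f1 w) <=
  disc_weight p w * norm (f w) + c * disc_weight p (disc_involution z w)).
{ intros w Hw; rewrite <- Hpeak, <- Rmult_plus_distr_l by auto.
  apply Rmult_le_compat_l; [left; apply disc_weight_pos|apply norm_triangle]. }
(* Both summands at z are nonnegative real multiples of f(z), and the weighted peak is v(0) = 1
   there. *)
assert (Hf1z : disc_weight p z * norm (f1 z) = disc_weight p z * norm (f z) + c).
{ pose proof (weight_mult_Cmod_disc_peak p z z Hz Hz) as Ez.
  rewrite disc_involution_diag in Ez by auto.
  assert (E0 : disc_weight p (RtoC 0) = 1).
  { unfold disc_weight, Rpower; rewrite Cmod_0; replace (1 - 0 ^ 2) with 1 by ring.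
    rewrite ln_1, Rmult_0_r; apply exp_0. }
  rewrite E0 in Ez.
  assert (E1 : f1 z =
    scal (RtoC (1 + Cmod (disc_peak p z z) * (c / norm (f z))) : C_AbsRing) (f z)).
  { unfold f1, x; rewrite disc_peak_diag at 1 by auto.
    rewrite (scal_assoc (V := F)), RtoC_plus, RtoC_mult.
    rewrite <- (scal_one (V := F) (f z)) at 1.
    symmetry; apply (scal_distr_r (V := F)). }
  assert (P : 0 <= Cmod (disc_peak p z z) * (c / norm (f z))).
  { apply Rmult_le_pos; [apply Cmod_ge_0|left; now apply Rdiv_lt_0_compat]. }
  rewrite E1, norm_scal_C, Cmod_R, Rabs_pos_eq by lra.
  transitivity (disc_weight p z * norm (f z)
    + disc_weight p z * Cmod (disc_peak p z z) * c); [field; lra|rewrite Ez; ring]. }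
destruct (pseudohyperbolic_disc_bounded z r Hz ltac:(lra)) as (R0 & [R00 R01] & HR0).
(* The maximiser is first sought in the larger Euclidean disc; [Hfar] then makes this maximum global
   and forces z0 into the pseudohyperbolic disc. *)
destruct (disc_max_attained R0 (fun w => disc_weight p w * norm (f1 w)))
  as (z0 & Hz0 & Hmax); [lra| |].
{ intros w Hw e e0.
  destruct (weighted_norm_continuous p f1 w ltac:(lra) (Hf1d w ltac:(lra)) e e0)
    as (d & d0 & Hd).
  exists d; split; auto; intros u Hu; destruct (Hd u Hu) as [_ K].
  apply Rabs_lt_between in K; lra. }
assert (Uz0 : Cmod z0 < 1) by lra.
set (N := disc_weight p z0 * norm (f1 z0)) in *.
assert (HNz : disc_weight p z * norm (f z) + c <= N).
{ rewrite <- Hf1z; apply Hmax, HR0; auto.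
  rewrite disc_involution_diag, Cmod_0 by auto; lra. }
assert (Hfar : forall w, Cmod w < 1 -> r < Cmod (disc_involution z w) ->
  disc_weight p w * norm (f1 w) < N).
{ intros w Hw Hr.
  pose proof (disc_weight_antitone p r (disc_involution z w) ltac:(lra)
    (disc_involution_in_disc z w Hz Hw) ltac:(lra)) as K; fold vr in K.
  specialize (Hf1 w Hw); specialize (Hv1 w Hw); nra. }
assert (HN : forall w, Cmod w < 1 -> disc_weight p w * norm (f1 w) <= N).
{ intros w Hw; destruct (Rle_lt_dec (Cmod (disc_involution z w)) r) as [Hr|Hr].
  - apply Hmax, HR0; auto.
  - left; now apply Hfar. }
assert (Hz0r : Cmod (disc_involution z z0) <= r).
{ apply Rnot_lt_le; intros Hr; specialize (Hfar z0 Uz0 Hr); unfold N in Hfar; lra. }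
assert (N1 : 1 <= N) by nra.
assert (N2 : N <= 1 + c).
{ pose proof (Hf1 z0 Uz0); pose proof (Hv1 z0 Uz0).
  pose proof (disc_weight_le_1 p (disc_involution z z0) ltac:(lra) ltac:(lra)).
  unfold N; nra. }
destruct (Hclose z z0 lambda Hz Uz0 Hlambda Hz0r) as (lambda0 & Hlambda0 & Hdual).
set (f0 := fun w => scal (RtoC (/ N) : C_AbsRing) (f1 w)).
assert (Hf0 : forall w, norm (f0 w) = / N * norm (f1 w)).
{ intros w; unfold f0; rewrite norm_scal_C, Cmod_R, Rabs_pos_eq; auto.
  left; apply Rinv_0_lt_compat; lra. }
assert (Hf0z : disc_weight p z0 * norm (f0 z0) = 1).
{ rewrite Hf0; transitivity (/ N * N); [unfold N at 3; ring|field; lra]. }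
assert (Hw0 : wnorm unit_disc (disc_weight p) f0 = 1).
{ apply (wnorm_eq_max _ _ _ _ (z0 : C_NormedModule)); auto.
  intros w Hw; rewrite Hf0; specialize (HN w Hw).
  apply (Rmult_le_reg_l N); [lra|].
  replace (N * (disc_weight p w * (/ N * norm (f1 w))))
    with (disc_weight p w * norm (f1 w)) by (field; lra); lra. }
exists f0, lambda0, z0; repeat split; auto.
- intros w Hw; destruct (Hf1d w Hw) as [l Hl].
  exists (fun u => scal (RtoC (/ N) : C_AbsRing) (l u)).
  apply (filterdiff_scal_r_fct (K := C_AbsRing)); [apply Cmult_comm|exact Hl].
- rewrite Hw0; exact I.
- apply (Rbar_le_lt_trans _ (c + c)); [|unfold c; simpl; lra].
  apply wnorm_le; intros w Hw.
  (* Normalisation costs (1 - 1/N) N = N - 1 <= c and the bump costs at most c, in total 2c =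
     eps/4. *)
  assert (E : minus (f w) (f0 w) = minus (scal (RtoC (1 - / N) : C_AbsRing) (f1 w))
    (scal (disc_peak p z w : C_AbsRing) x)).
  { unfold f0; rewrite RtoC_minus.
    transitivity (minus (minus (f1 w) (scal (RtoC (/ N) : C_AbsRing) (f1 w)))
      (scal (disc_peak p z w : C_AbsRing) x)).
    - exact (minus_shift (G := F) (f w) _ _).
    - apply (f_equal (fun y => minus y _)); symmetry.
      exact (scal_one_minus (V := F) (RtoC (/ N) : C_AbsRing) (f1 w)). }
  rewrite E.
  eapply Rle_trans; [apply Rmult_le_compat_l;
    [left; apply disc_weight_pos|apply norm_minus_triangle]|].
  rewrite Rmult_plus_distr_l, Hpeak, norm_scal_C, Cmod_R by auto.
  assert (iN : / N <= 1) by (rewrite <- Rinv_1; apply Rinv_le_contravar; lra).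
  rewrite Rabs_pos_eq by lra.
  specialize (HN w Hw).
  pose proof (disc_weight_le_1 p (disc_involution z w) ltac:(lra)
    (disc_involution_in_disc z w Hz Hw)).
  assert (disc_weight p w * ((1 - / N) * norm (f1 w)) <= (1 - / N) * N).
  { rewrite <- Rmult_assoc, (Rmult_comm (disc_weight p w)), Rmult_assoc.
    apply Rmult_le_compat_l; lra. }
  replace ((1 - / N) * N) with (N - 1) in * by (field; lra).
  nra.
- apply (Rbar_le_lt_trans _ (eps / 2)); [|simpl; lra].
  apply Lub_Rbar_correct; intros y (h & Hh & ->); exact (Hdual h Hh).
Qed.
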